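(* Fix a signature and isdef-formulas $\delta$ on it, let $\Gamma$ be a set of formulas and $\varphi$ a formula. (1) If $\Gamma\not\vdash\mathsf{F}$, then $(\delta,\Gamma)$ has a model. (2) If $\Gamma\models\varphi$, then $\Gamma\vdash\varphi$.
   Context: Syntax: a signature has countable sets of constant, function and relation symbols with positive integer arities; variables $\mathtt{v}_1,\mathtt{v}_2,\dots$ (countably infinitely many). Terms: variables, constants, $f(t_1,\dots,t_n)$. Atomic formulas: $\mathsf{F}$, $\mathsf{T}$, $(t_1=t_2)$, $R(t_1,\dots,t_n)$. Formulas use $\neg,\wedge,\vee,\forall x,\exists x$ only; $\wedge,\vee$ associate to the left. $\varphi(t)$ replaces every free occurrence of $x$ in $\varphi(x)$ by $t$; $t$ is free for $x$ in $\varphi(x)$ if no variable of $t$ becomes bound in $\varphi(t)$. Semantics: a structure $\sigma$ has a nonempty domain $\mathbb{D}$, elements for constants, partial functions $\mathbb{D}^n\to\mathbb{D}$ for $n$-ary function symbols, subsets of $\mathbb{D}^n$ for relation symbols; an assignment is $\nu:\mathbb{Z}^+\to\mathbb{D}$, $\nu(\mathtt{v}_i)=\nu(i)$, $\nu[x:=d]$ changes the value of $x$ to $d$. A compound term is defined iff all arguments are defined and the function is defined at their values. Truth values in $\{\mathsf{F},\mathsf{U},\mathsf{T}\}$ ordered $\mathsf{F}<\mathsf{U}<\mathsf{T}$: $\mathsf{F},\mathsf{T}$ denote themselves; equality/relation atoms are $\mathsf{U}$ if some argument term is undefined, else classical $\mathsf{T}$/$\mathsf{F}$; $\neg$ swaps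 $\mathsf{F},\mathsf{T}$ and fixes $\mathsf{U}$; $\wedge$ min, $\vee$ max; $\forall x\,\varphi$ min and $\exists x\,\varphi$ max of the value of $\varphi$ under $\nu[x:=d]$ over $d\in\mathbb{D}$. Isdef-formulas $\delta$: for each $n$-ary function symbol $f$ a formula $\delta_f$ with free variables among $\mathtt{v}_1,\dots,\mathtt{v}_n$, such that $\delta_g$ is literally $\mathsf{T}$ for every function symbol $g$ occurring in $\delta_f$. $\sigma\models\delta$ iff for all $f$ and $d_1,\dots,d_n\in\mathbb{D}$: $\delta_f$ has value $\mathsf{T}$ under assignments with $\mathtt{v}_i\mapsto d_i$ iff $f$'s interpretation is defined at $(d_1,\dots,d_n)$. A model of $(\delta,\Gamma)$ is a pair $(\sigma,\nu)$ with $\sigma\models\delta$ and every formula of $\Gamma$ having value $\mathsf{T}$; $\Gamma\models\varphi$ iff every model of $(\delta,\Gamma)$ gives $\varphi$ value $\mathsf{T}$. $\mathrm{Def}$ (syntactic operation producing formulas): $\mathrm{Def}(x)=\mathrm{Def}(c)=\mathsf{T}$; $\mathrm{Def}(f(t_1,\dots,t_n))=\mathrm{Def}(t_1)\wedge\cdots\wedge\mathrm{Def}(t_n)\wedge\delta_f(t_1,\dots,t_n)$ ($\delta_f$ with bound variables renamed so each $t_i$ is free for $\mathtt{v}_i$, then $t_i$ substituted for free $\mathtt{v}_i$); $\mathrm{Def}(\mathsf{F})=\mathrm{Def}(\mathsf{T})=\mathsf{T}$; $\mathrm{Def}(t_1=t_2)=\mathrm{Def}(t_1)\wedge\mathrm{Def}(t_2)$;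 $\mathrm{Def}(R(t_1,\dots,t_n))=\mathrm{Def}(t_1)\wedge\cdots\wedge\mathrm{Def}(t_n)$; $\mathrm{Def}(\neg\varphi)=\mathrm{Def}(\varphi)$; $\mathrm{Def}(\varphi\wedge\psi)=(\mathrm{Def}(\varphi)\wedge\mathrm{Def}(\psi))\vee(\mathrm{Def}(\varphi)\wedge\neg\varphi)\vee(\mathrm{Def}(\psi)\wedge\neg\psi)$; $\mathrm{Def}(\varphi\vee\psi)=(\mathrm{Def}(\varphi)\wedge\mathrm{Def}(\psi))\vee(\mathrm{Def}(\varphi)\wedge\varphi)\vee(\mathrm{Def}(\psi)\wedge\psi)$; $\mathrm{Def}(\forall x\,\varphi)=(\forall x\,\mathrm{Def}(\varphi))\vee\exists x\,(\mathrm{Def}(\varphi)\wedge\neg\varphi)$; $\mathrm{Def}(\exists x\,\varphi)=(\forall x\,\mathrm{Def}(\varphi))\vee\exists x\,(\mathrm{Def}(\varphi)\wedge\varphi)$. Proof system: $\Gamma\vdash\varphi$ is the least relation closed under: P1 $\{\varphi\}\vdash\varphi$; P2 if $\Gamma\vdash\varphi$ then $\Gamma\cup\Delta\vdash\varphi$; P3 if $\Gamma\vdash\varphi$ and $\Gamma\cup\{\varphi\}\vdash\psi$ then $\Gamma\vdash\psi$; C1 $\emptyset\vdash(\varphi\vee\neg\varphi)\vee\neg\mathrm{Def}(\varphi)$; C2 $\{\mathsf{F}\}\vdash\varphi$; C3 $\{\varphi,\neg\varphi\}\vdash\mathsf{F}$; D1 $\{\varphi\}\vdash\mathrm{Def}(\varphi)$;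 $\wedge$-I $\{\varphi,\psi\}\vdash\varphi\wedge\psi$; $\wedge$-E1 $\{\varphi\wedge\psi\}\vdash\varphi$; $\wedge$-E2 $\{\varphi\wedge\psi\}\vdash\psi$; $\vee$-I1 $\{\varphi\}\vdash\varphi\vee\psi$; $\vee$-I2 $\{\psi\}\vdash\varphi\vee\psi$; $\vee$-E if $\Gamma\cup\{\varphi\}\vdash\chi$ and $\Gamma\cup\{\psi\}\vdash\chi$ then $\Gamma\cup\{\varphi\vee\psi\}\vdash\chi$; $=$-1 $\{\mathrm{Def}(t)\}\vdash(t=t)$; $=$-2 if $\varphi(x_1,\dots,x_n)$ is a formula with distinct variables $x_j$, $1\le i\le n$, and $t_i,t'_i$ are free for $x_i$, then $\{(t_i=t'_i),\varphi(t_1,\dots,t_n)\}\vdash\varphi(t_1,\dots,t'_i,\dots,t_n)$; $\forall$-E if $t$ is free for $x$ in $\varphi(x)$ then $\{\mathrm{Def}(t),\forall x\,\varphi(x)\}\vdash\varphi(t)$; $\forall$-I if $\Gamma\vdash\varphi(x)$ and $x$ does not occur free in $\Gamma$ then $\Gamma\vdash\forall x\,\varphi(x)$; $\exists$-I if $t$ is free for $x$ in $\varphi(x)$ then $\{\varphi(t)\}\vdash\exists x\,\varphi(x)$; $\exists$-E if $\Gamma\cup\{\varphi(y)\}\vdash\psi$ and $y$ occurs neither in $\Gamma$, in $\exists x\,\varphi(x)$, nor in $\psi$, then $\Gamma\cup\{\exists x\,\varphi(x)\}\vdash\psi$. $\Gamma\not\vdash\mathsf{F}$ means $\Gamma\vdash\mathsf{F}$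 does not hold. *)

(* Defs.v *)
From mathcomp Require Import all_boot.
From mathcomp Require Import boolp classical_sets.

Set Implicit Arguments.
Unset Strict Implicit.
Unset Printing Implicit Defensive.

Local Open Scope classical_set_scope.

Record signature := Signature {
  const : countType;
  func : countType;
  rel_sym : countType;
  farity : func -> nat;
  rarity : rel_sym -> nat;
  farity_gt0 : forall f, 0 < farity f;
  rarity_gt0 : forall r, 0 < rarity r }.

(* The variable [i : nat] is v_(i+1); so the variables v_1, ..., v_n are the
   naturals below n, i.e. the values of ['I_n]. *)
Definition var := nat.

Inductive term (S : signature) : Type :=
| Var of var
| Cst of const S
| App (f : func S) of {ffun 'I_(farity f) -> term S}.

Inductive formula (S : signature) : Type :=
| Fls
| Tru
| Eq of term S & term S
| Rel (r : rel_sym S) of {ffun 'I_(rarity r) -> term S}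
| Neg of formula S
| And of formula S & formula S
| Or of formula S & formula S
| All of var & formula S
| Ex of var & formula S.

Arguments Var {S} _.
Arguments Cst {S} _.
Arguments App {S} f _.
Arguments Fls {S}.
Arguments Tru {S}.
Arguments Rel {S} r _.

Section Syntax.
Variable S : signature.
Implicit Types (t : term S) (phi psi : formula S) (x y : var).

Fixpoint tocc x t : bool :=
  match t with
  | Var y => x == y
  | Cst _ => false
  | App f ts => [exists i, tocc x (ts i)]
  end.

(* Any occurrence: free, bound, or right after a quantifier. *)
Fixpoint occ x phi : bool :=
  match phi with
  | Fls | Tru => false
  | Eq t u => tocc x t || tocc x u
  | Rel r ts => [exists i, tocc x (ts i)]
  | Neg p => occ x p
  | And p q | Or p q => occ x p || occ x q
  | All y p | Ex y p => (x == y) || occ x p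
  end.

Fixpoint free x phi : bool :=
  match phi with
  | Fls | Tru => false
  | Eq t u => tocc x t || tocc x u
  | Rel r ts => [exists i, tocc x (ts i)]
  | Neg p => free x p
  | And p q | Or p q => free x p || free x q
  | All y p | Ex y p => (x != y) && free x p
  end.

Fixpoint tfun_occ (g : func S) t : bool :=
  match t with
  | Var _ | Cst _ => false
  | App f ts => (g == f) || [exists i, tfun_occ g (ts i)]
  end.

Fixpoint fun_occ (g : func S) phi : bool :=
  match phi with
  | Fls | Tru => false
  | Eq t u => tfun_occ g t || tfun_occ g u
  | Rel r ts => [exists i, tfun_occ g (ts i)]
  | Neg p => fun_occ g p
  | And p q | Or p q => fun_occ g p || fun_occ g q
  | All _ p | Ex _ p => fun_occ g p
  end.

Definition upd (A : Type) (s : var -> A) x (a : A) : var -> A :=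
  fun y => if y == x then a else s y.

Fixpoint tsubst (s : var -> term S) t : term S :=
  match t with
  | Var x => s x
  | Cst c => Cst c
  | App f ts => App f [ffun i => tsubst s (ts i)]
  end.

(* Simultaneous replacement of the free occurrences of every variable x by
   [s x]; bound variables are not renamed, so capture is possible and has to
   be excluded by [free_for]. *)
Fixpoint subst (s : var -> term S) phi : formula S :=
  match phi with
  | Fls => Fls
  | Tru => Tru
  | Eq t u => Eq (tsubst s t) (tsubst s u)
  | Rel r ts => Rel r [ffun i => tsubst s (ts i)]
  | Neg p => Neg (subst s p)
  | And p q => And (subst s p) (subst s q)
  | Or p q => Or (subst s p) (subst s q)
  | All y p => All y (subst (upd s y (Var y)) p)
  | Ex y p => Ex y (subst (upd s y (Var y)) p)
  end.

Definition subst1 x t phi : formula S := subst (upd Var x t) phi.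

(* Meant for injective [xs]. *)
Definition substn n (xs : 'I_n -> var) (ts : 'I_n -> term S) phi : formula S :=
  subst (fun x => if [pick i | xs i == x] is Some i then ts i else Var x) phi.

Fixpoint free_for t x phi : bool :=
  match phi with
  | Fls | Tru | Eq _ _ | Rel _ _ => true
  | Neg p => free_for t x p
  | And p q | Or p q => free_for t x p && free_for t x q
  | All y p | Ex y p =>
      ~~ ((x != y) && free x p) || (~~ tocc y t && free_for t x p)
  end.

Inductive alpha : formula S -> formula S -> Prop :=
| alpha_refl phi : alpha phi phi
| alpha_sym phi psi : alpha phi psi -> alpha psi phi
| alpha_trans phi psi chi : alpha phi psi -> alpha psi chi -> alpha phi chi
| alpha_Neg phi phi' : alpha phi phi' -> alpha (Neg phi) (Neg phi')
| alpha_And phi phi' psi psi' :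
    alpha phi phi' -> alpha psi psi' -> alpha (And phi psi) (And phi' psi')
| alpha_Or phi phi' psi psi' :
    alpha phi phi' -> alpha psi psi' -> alpha (Or phi psi) (Or phi' psi')
| alpha_All x phi phi' : alpha phi phi' -> alpha (All x phi) (All x phi')
| alpha_Ex x phi phi' : alpha phi phi' -> alpha (Ex x phi) (Ex x phi')
| alpha_renAll x y phi :
    ~~ occ y phi -> alpha (All x phi) (All y (subst1 x (Var y) phi))
| alpha_renEx x y phi :
    ~~ occ y phi -> alpha (Ex x phi) (Ex y (subst1 x (Var y) phi)).

(* Left-associated conjunction; only ever used on nonempty sequences. *)
Definition conj (s : seq (formula S)) : formula S :=
  if s is p :: s' then foldl (@And S) p s' else Tru.

End Syntax.

Record isdef (S : signature) := Isdef {
  delta :> func S -> formula S;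
  delta_free : forall f x, free x (delta f) -> x < farity f;
  delta_Tru : forall f g, fun_occ g (delta f) -> delta g = Tru }.

(* Which bound variables of delta_f are renamed, and to what, when forming
   delta_f(t_1,...,t_n) is left open; a [renaming] is any such choice.  There
   is at least one: see [renaming_exists] below. *)
Record renaming (S : signature) (delta : isdef S) := Renaming {
  renamed : forall f : func S, {ffun 'I_(farity f) -> term S} -> formula S;
  renamed_alpha : forall f (ts : {ffun 'I_(farity f) -> term S}),
    alpha (delta f) (renamed ts);
  renamed_free_for : forall f (ts : {ffun 'I_(farity f) -> term S}) i,
    free_for (ts i) i (renamed ts) }.

Section RenamingExists.
Variable S : signature.
Implicit Types (t : term S) (phi psi : formula S).

Fixpoint bound (x : var) phi : bool :=
  match phi with
  | Fls | Tru | Eq _ _ | Rel _ _ => false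
  | Neg p => bound x p
  | And p q | Or p q => bound x p || bound x q
  | All y p | Ex y p => (x == y) || bound x p
  end.

Lemma fin_bound n (P : 'I_n -> var -> bool) :
  (forall i, exists N, forall x, P i x -> x < N) ->
  exists N, forall x, [exists i, P i x] -> x < N.
Proof.
move=> /choice[g Pg]; exists (\max_i g i) => x /existsP[i /Pg ltx].
exact: leq_trans ltx (leq_bigmax i).
Qed.

Lemma tocc_bound t : exists N, forall x, tocc x t -> x < N.
Proof.
move: t; fix IH 1 => -[y|c|f ts].
- by exists y.+1 => x /eqP->.
- by exists 0.
- by apply: fin_bound => i; exact: IH (ts i).
Qed.

Lemma occ_bound phi : exists N, forall x, occ x phi -> x < N.
Proof.
have U (P Q : var -> bool) : (exists N, forall x, P x -> x < N) ->
    (exists N, forall x, Q x -> x < N) ->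
    exists N, forall x, P x || Q x -> x < N.
  move=> [N PN] [N' QN]; exists (maxn N N') => x /orP[/PN|/QN] ltx;
  by rewrite leq_max ltx ?orbT.
have E y : exists N, forall x, x == y -> x < N by exists y.+1 => x /eqP->.
elim: phi => /= [||t u|r ts|p //|p IHp q IHq|p IHp q IHq|y p IHp|y p IHp];
  try exact: U; try by exists 0.
- by apply: U; exact: tocc_bound.
- by apply: fin_bound => i; exact: tocc_bound.
Qed.

Lemma bound_subst s x phi : bound x (subst s phi) = bound x phi.
Proof.
by elim: phi s => //= [p IHp q IHq|p IHp q IHq|y p IHp|y p IHp] s;
  rewrite ?IHp ?IHq.
Qed.

Lemma alpha_avoid N phi :
  exists2 psi, alpha phi psi & forall x, bound x psi -> N <= x.
Proof.
have B (p : formula S) : exists2 y, N <= y & ~~ occ y p.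
  have [M oM] := occ_bound p; exists (maxn N M); first exact: leq_maxl.
  by apply/negP => /oM; rewrite ltnNge leq_maxr.
elim: phi => [||t u|r ts|p [p' a b]|p [p' a b] q [q' c d]
  |p [p' a b] q [q' c d]|x p [p' a b]|x p [p' a b]].
- by exists Fls => //; exact: alpha_refl.
- by exists Tru => //; exact: alpha_refl.
- by exists (Eq t u) => //; exact: alpha_refl.
- by exists (Rel r ts) => //; exact: alpha_refl.
- by exists (Neg p') => //; exact: alpha_Neg.
- exists (And p' q'); first exact: alpha_And.
  by move=> x /= /orP[/b|/d].
- exists (Or p' q'); first exact: alpha_Or.
  by move=> x /= /orP[/b|/d].
- have [y leNy oy] := B p'; exists (All y (subst1 x (Var y) p')).
    exact: alpha_trans (alpha_All x a) (alpha_renAll x oy).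
  by move=> z /= /orP[/eqP->//|]; rewrite bound_subst => /b.
- have [y leNy oy] := B p'; exists (Ex y (subst1 x (Var y) p')).
    exact: alpha_trans (alpha_Ex x a) (alpha_renEx x oy).
  by move=> z /= /orP[/eqP->//|]; rewrite bound_subst => /b.
Qed.

Lemma free_for_bound t x phi :
  (forall y, tocc y t -> ~~ bound y phi) -> free_for t x phi.
Proof.
have Q y (p : formula S) : (forall z, tocc z t -> ~~ ((z == y) || bound z p)) ->
    ~~ tocc y t /\ forall z, tocc z t -> ~~ bound z p.
  move=> h; split=> [|z /h]; last by rewrite negb_or => /andP[].
  by apply/negP => /h; rewrite eqxx.
have R (p q : formula S) : (forall y, tocc y t -> ~~ (bound y p || bound y q)) ->
    (forall z, tocc z t -> ~~ bound z p) /\ (forall z, tocc z t -> ~~ bound z q).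
  by move=> h; split=> z /h; rewrite negb_or => /andP[].
elim: phi => //= [p IHp q IHq /R[/IHp-> /IHq->]|p IHp q IHq /R[/IHp-> /IHq->]
  |y p IHp /Q[-> /IHp->]|y p IHp /Q[-> /IHp->]] //=; exact: orbT.
Qed.

Lemma renaming_exists (delta : isdef S) : inhabited (renaming delta).
Proof.
have H f (ts : {ffun 'I_(farity f) -> term S}) :
    {psi | alpha (delta f) psi /\
           forall i : 'I_(farity f), free_for (ts i) i psi}.
  apply: cid.
  have [N tN] := fin_bound (fun i => tocc_bound (ts i)).
  have [psi a b] := alpha_avoid N (delta f).
  exists psi; split=> // i; apply: free_for_bound => y oy.
  apply/negP => /b; rewrite leqNgt => /negP; apply; apply: tN.
  by apply/existsP; exists i.
split; apply: (@Renaming _ _ (fun f ts => sval (H f ts))) => f ts.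
  by have [] := svalP (H f ts).
by have [] := svalP (H f ts).
Qed.

End RenamingExists.

Section Def.
Variables (S : signature) (delta : isdef S) (rho : renaming delta).

Definition delta_at (f : func S) (ts : {ffun 'I_(farity f) -> term S}) :
    formula S :=
  substn (fun i => nat_of_ord i) ts (renamed rho ts).

Fixpoint tDef (t : term S) : formula S :=
  match t with
  | Var _ | Cst _ => Tru
  | App f ts =>
      conj (rcons [seq tDef (ts i) | i <- enum 'I_(farity f)] (delta_at ts))
  end.

Fixpoint Def (phi : formula S) : formula S :=
  match phi with
  | Fls | Tru => Tru
  | Eq t u => And (tDef t) (tDef u)
  | Rel r ts => conj [seq tDef (ts i) | i <- enum 'I_(rarity r)]
  | Neg p => Def p
  | And p q => Or (Or (And (Def p) (Def q)) (And (Def p) (Neg p)))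
                  (And (Def q) (Neg q))
  | Or p q => Or (Or (And (Def p) (Def q)) (And (Def p) p)) (And (Def q) q)
  | All x p => Or (All x (Def p)) (Ex x (And (Def p) (Neg p)))
  | Ex x p => Or (All x (Def p)) (Ex x (And (Def p) p))
  end.

Inductive provable : set (formula S) -> formula S -> Prop :=
| P1 phi : provable [set phi] phi
| P2 Gamma Delta phi : provable Gamma phi -> provable (Gamma `|` Delta) phi
| P3 Gamma phi psi :
    provable Gamma phi -> provable (Gamma `|` [set phi]) psi ->
    provable Gamma psi
| C1 phi : provable set0 (Or (Or phi (Neg phi)) (Neg (Def phi)))
| C2 phi : provable [set Fls] phi
| C3 phi : provable [set phi; Neg phi] Fls
| D1 phi : provable [set phi] (Def phi)
| AndI phi psi : provable [set phi; psi] (And phi psi)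
| AndE1 phi psi : provable [set And phi psi] phi
| AndE2 phi psi : provable [set And phi psi] psi
| OrI1 phi psi : provable [set phi] (Or phi psi)
| OrI2 phi psi : provable [set psi] (Or phi psi)
| OrE Gamma phi psi chi :
    provable (Gamma `|` [set phi]) chi ->
    provable (Gamma `|` [set psi]) chi ->
    provable (Gamma `|` [set Or phi psi]) chi
| Eq1 t : provable [set tDef t] (Eq t t)
| Eq2 phi n (xs : 'I_n -> var) (ts : 'I_n -> term S) (i : 'I_n) (t' : term S) :
    injective xs ->
    (forall j, free_for (ts j) (xs j) phi) ->
    free_for t' (xs i) phi ->
    provable [set Eq (ts i) t'; substn xs ts phi]
             (substn xs (fun j => if j == i then t' else ts j) phi)
| AllE x t phi :
    free_for t x phi -> provable [set tDef t; All x phi] (subst1 x t phi)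
| AllI Gamma x phi :
    provable Gamma phi -> (forall psi, Gamma psi -> ~~ free x psi) ->
    provable Gamma (All x phi)
| ExI x t phi : free_for t x phi -> provable [set subst1 x t phi] (Ex x phi)
| ExE Gamma x y phi psi :
    provable (Gamma `|` [set subst1 x (Var y) phi]) psi ->
    (forall chi, Gamma chi -> ~~ occ y chi) ->
    ~~ occ y (Ex x phi) -> ~~ occ y psi ->
    provable (Gamma `|` [set Ex x phi]) psi.

End Def.

Inductive tval := vF | vU | vT.

Definition vneg (a : tval) : tval :=
  match a with vF => vT | vU => vU | vT => vF end.

(* Minimum and maximum for the order vF < vU < vT. *)
Definition vmin (a b : tval) : tval :=
  match a, b with
  | vF, _ | _, vF => vF
  | vU, _ | _, vU => vU
  | vT, vT => vT
  end.

Definition vmax (a b : tval) : tval :=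
  match a, b with
  | vT, _ | _, vT => vT
  | vU, _ | _, vU => vU
  | vF, vF => vF
  end.

Definition vinf (D : Type) (h : D -> tval) : tval :=
  if `[< exists d, h d = vF >] then vF
  else if `[< exists d, h d = vU >] then vU else vT.

Definition vsup (D : Type) (h : D -> tval) : tval :=
  if `[< exists d, h d = vT >] then vT
  else if `[< exists d, h d = vU >] then vU else vF.

Definition vclassical (P : Prop) : tval := if `[< P >] then vT else vF.

Record structure (S : signature) := Structure {
  dom : Type;
  dom_inh : inhabited dom;
  cI : const S -> dom;
  fI : forall f : func S, {ffun 'I_(farity f) -> dom} -> option dom;
  rI : forall r : rel_sym S, set {ffun 'I_(rarity r) -> dom} }.

Definition assignment (S : signature) (M : structure S) := var -> dom M.

Section Semantics.
Variables (S : signature) (M : structure S).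

(* [Some] of the tuple of values if all of them are defined; the default [d]
   then plays no role. *)
Definition all_defined n (d : dom M) (vs : 'I_n -> option (dom M)) :
    option {ffun 'I_n -> dom M} :=
  if [forall i, isSome (vs i)] then Some [ffun i => odflt d (vs i)] else None.

Fixpoint teval (nu : assignment M) (t : term S) : option (dom M) :=
  match t with
  | Var x => Some (nu x)
  | Cst c => Some (cI M c)
  | App f ts => obind (fI (f := f)) (all_defined (nu 0) (fun i => teval nu (ts i)))
  end.

Fixpoint eval (nu : assignment M) (phi : formula S) : tval :=
  match phi with
  | Fls => vF
  | Tru => vT
  | Eq t u =>
      match teval nu t, teval nu u with
      | Some a, Some b => vclassical (a = b)
      | _, _ => vU
      end
  | Rel r ts =>
      if all_defined (nu 0) (fun i => teval nu (ts i)) is Some ds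
      then vclassical (rI ds) else vU
  | Neg p => vneg (eval nu p)
  | And p q => vmin (eval nu p) (eval nu q)
  | Or p q => vmax (eval nu p) (eval nu q)
  | All x p => vinf (fun d => eval (upd nu x d) p)
  | Ex x p => vsup (fun d => eval (upd nu x d) p)
  end.

Definition sat_isdef (delta : isdef S) : Prop :=
  forall (f : func S) (ds : {ffun 'I_(farity f) -> dom M}) (nu : assignment M),
    (forall i : 'I_(farity f), nu i = ds i) ->
    (eval nu (delta f) = vT <-> isSome (fI ds)).

Definition is_model (delta : isdef S) (Gamma : set (formula S))
    (nu : assignment M) : Prop :=
  sat_isdef delta /\ forall phi, Gamma phi -> eval nu phi = vT.

End Semantics.

Definition entails (S : signature) (delta : isdef S) (Gamma : set (formula S))
    (phi : formula S) : Prop :=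
  forall (M : structure S) (nu : assignment M),
    is_model delta Gamma nu -> eval nu phi = vT.

(* Main.v *)
(* Henkin's method for Kleene's strong three-valued logic. A consistent set is
   extended to a saturated one H (deductively closed, prime, with variables as
   witnesses); by C1 each formula p satisfies exactly one of "p in H",
   "~ p in H", "Def p not in H", and these are its values T, F, U in the model
   whose elements are the variables modulo provable equality. Any defined term
   t equals some variable, the witness of "exists x, x = t", so that variables
   suffice, and f is defined at given arguments iff delta_f holds of them in H.

   The renamings chosen in [delta_at] commute with substitution only up to bound
   variables, hence alpha-equivalent formulas must be shown interderivable. For
   a negation ~ p this involves Def p, which is not smaller; the recursion is
   well-founded since delta_f only contains symbols g with delta_g = T.

   Fresh variables are obtained by first replacing each v_i by v_(2i). For part
   (2), if phi does not follow from Gamma then by C1 one of ~ phi, ~ Def phi is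
   consistent with Gamma, and in the term model phi = T forces Def phi = T. *)
Require Import Defs.
From mathcomp Require Import all_boot.
From mathcomp Require Import boolp classical_sets.
From Stdlib Require List.

Set Implicit Arguments.
Unset Strict Implicit.
Unset Printing Implicit Defensive.

Local Open Scope classical_set_scope.

(** * Capture-avoiding substitution as a relation, and alpha-equivalence *)

Section Substitution.
Variable S : signature.
Implicit Types (t u : term S) (p q r phi psi chi : formula S) (x y z : var).
Implicit Types s : var -> term S.

(** The arguments of [App] lie inside a finite function; recursing directly through it supplies the
    induction hypothesis for each of them. *)
Lemma term_induction (P : term S -> Prop) :
  (forall x, P (Var x)) -> (forall c, P (Cst c)) ->
  (forall f (ts : {ffun 'I_(farity f) -> term S}),
     (forall i, P (ts i)) -> P (App f ts)) ->
  forall t, P t.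
Proof.
move=> PV PC PA; fix IH 1 => -[x|c|f ts]; [exact: PV|exact: PC|].
by apply: PA => i; exact: IH.
Qed.

Lemma updE (A : Type) (s : var -> A) x a : upd s x a x = a.
Proof. by rewrite /upd eqxx. Qed.

Lemma updN (A : Type) (s : var -> A) x a y : y != x -> upd s x a y = s y.
Proof. by rewrite /upd => /negPf->. Qed.

Lemma upd_Var x : upd (@Var S) x (Var x) = @Var S.
Proof. by apply/funext => y; rewrite /upd; case: eqP => // ->. Qed.

Lemma tsubst_ext s s' t :
  (forall x, tocc x t -> s x = s' x) -> tsubst s t = tsubst s' t.
Proof.
elim/term_induction: t => [x|c|f ts IH] //= e; first exact/e/eqxx.
congr App; apply/ffunP => i; rewrite !ffunE; apply: IH => x ox.
by apply: e; apply/existsP; exists i.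
Qed.

Lemma tsubst_Var t : tsubst Var t = t.
Proof.
elim/term_induction: t => [x|c|f ts IH] //=.
by congr App; apply/ffunP => i; rewrite !ffunE.
Qed.

Lemma tsubst_comp s1 s2 t :
  tsubst s2 (tsubst s1 t) = tsubst (fun x => tsubst s2 (s1 x)) t.
Proof.
elim/term_induction: t => [x|c|f ts IH] //=.
by congr App; apply/ffunP => i; rewrite !ffunE.
Qed.

Lemma tocc_tsubst w s t :
  tocc w (tsubst s t) <-> exists2 v, tocc v t & tocc w (s v).
Proof.
elim/term_induction: t => [x|c|f ts IH] /=.
- split=> [ow|[v /eqP-> //]]; exists x => //; exact: eqxx.
- by split=> // -[].
- split=> [/existsP[i]|[v /existsP[i ov ow]]].
    rewrite ffunE => /IH[v ov ow]; exists v => //; apply/existsP; by exists i.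
  by apply/existsP; exists i; rewrite ffunE; apply/IH; exists v.
Qed.

(* [is_subst s phi psi]: psi is, up to renaming of bound variables, the
   capture-avoiding substitution of s in phi; thus [is_subst Var] is
   alpha-equivalence. *)
Fixpoint is_subst s phi psi : Prop :=
  match phi with
  | Fls => psi = Fls
  | Tru => psi = Tru
  | Eq t u => psi = Eq (tsubst s t) (tsubst s u)
  | Rel r ts => psi = Rel r [ffun i => tsubst s (ts i)]
  | Neg p => exists2 p', psi = Neg p' & is_subst s p p'
  | And p q => exists p' q', [/\ psi = And p' q', is_subst s p p' & is_subst s q q']
  | Or p q => exists p' q', [/\ psi = Or p' q', is_subst s p p' & is_subst s q q']
  | All x p => exists y q, [/\ psi = All y q,
      forall z, free z (All x p) -> ~~ tocc y (s z) & is_subst (upd s x (Var y)) p q]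
  | Ex x p => exists y q, [/\ psi = Ex y q,
      forall z, free z (Ex x p) -> ~~ tocc y (s z) & is_subst (upd s x (Var y)) p q]
  end.

Lemma upd_ext p s s' x t :
  (forall z, (z != x) && free z p -> s z = s' z) ->
  forall z, free z p -> upd s x t z = upd s' x t z.
Proof. by move=> e z fz; rewrite /upd; case: eqP => // /eqP xz; apply: e; rewrite xz. Qed.

Lemma is_subst_ext s s' phi psi :
  (forall x, free x phi -> s x = s' x) -> is_subst s phi psi -> is_subst s' phi psi.
Proof.
elim: phi psi s s' => /= [||t u|r ts|p IH|p IHp q IHq|p IHp q IHq|x p IH|x p IH]
  psi s s' e //.
- by move=> ->; congr Eq; apply: tsubst_ext => x ox; apply: e; rewrite ox ?orbT.
- move=> ->; congr Rel; apply/ffunP => i; rewrite !ffunE; apply: tsubst_ext => x ox.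
  by apply: e; apply/existsP; exists i.
- by case=> p' -> sp; exists p' => //; exact: IH sp.
- case=> p' [q' [-> sp sq]]; exists p', q'; split=> //.
    by apply: IHp sp => x fx; apply: e; rewrite fx.
  by apply: IHq sq => x fx; apply: e; rewrite fx orbT.
- case=> p' [q' [-> sp sq]]; exists p', q'; split=> //.
    by apply: IHp sp => x fx; apply: e; rewrite fx.
  by apply: IHq sq => x fx; apply: e; rewrite fx orbT.
- case=> y [q [-> fr sp]]; exists y, q; split=> // [z fz|].
    by rewrite -e //; exact: fr.
  by apply: IH sp; exact: upd_ext.
- case=> y [q [-> fr sp]]; exists y, q; split=> // [z fz|].
    by rewrite -e //; exact: fr.
  by apply: IH sp; exact: upd_ext.
Qed.

(** Quantifier case of [is_subst_free]: [P] and [Q] are the free variables of the body before and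
    after substitution, the bound variable changing from [x] to [y]. Freshness of [y] ensures that
    no variable of an image is captured. *)
Lemma free_upd (P : var -> bool) (Q : var -> bool) s x y :
  (forall w, Q w <-> exists2 v, P v & tocc w (upd s x (Var y) v)) ->
  (forall z, (z != x) && P z -> ~~ tocc y (s z)) ->
  forall w, (w != y) && Q w <-> exists2 v, (v != x) && P v & tocc w (s v).
Proof.
move=> h fr w; split=> [/andP[wy /h[v fv]]|[v /andP[vx fv] ow]].
  case: (eqVneq v x) => [->|vx]; first by rewrite updE /= (negPf wy).
  by rewrite updN // => ow; exists v => //; rewrite vx.
have -> /= : w != y.
  by apply/eqP => wy; move: (fr v); rewrite vx fv -wy ow => /(_ isT).
by apply/h; exists v => //; rewrite updN.
Qed.

Lemma is_subst_free s phi psi :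
  is_subst s phi psi -> forall w, free w psi <-> exists2 v, free v phi & tocc w (s v).
Proof.
have U (P P' Q Q' : var -> bool) s' : (forall w, P' w <-> exists2 v, P v & tocc w (s' v)) ->
    (forall w, Q' w <-> exists2 v, Q v & tocc w (s' v)) ->
    forall w, P' w || Q' w <-> exists2 v, P v || Q v & tocc w (s' v).
  move=> hP hQ w; split=> [/orP[/hP|/hQ] [v a b]|[v /orP[] a b]].
  - by exists v; rewrite ?a.
  - by exists v; rewrite ?a ?orbT.
  - by apply/orP; left; apply/hP; exists v.
  - by apply/orP; right; apply/hQ; exists v.
elim: phi psi s => /= [||t u|r ts|p IH|p IHp q IHq|p IHp q IHq|x p IH|x p IH]
  psi s.
- by move=> -> w; split=> // -[].
- by move=> -> w; split=> // -[].
- by move=> -> /=; apply: U => w; exact: tocc_tsubst.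
- move=> -> w /=; split=> [/existsP[i]|[v /existsP[i ov] ow]].
    rewrite ffunE => /tocc_tsubst[v ov ow]; exists v => //.
    by apply/existsP; exists i.
  by apply/existsP; exists i; rewrite ffunE; apply/tocc_tsubst; exists v.
- by case=> p' -> /IH.
- by case=> p' [q' [-> sp sq]] /=; apply: U; [exact: IHp sp|exact: IHq sq].
- by case=> p' [q' [-> sp sq]] /=; apply: U; [exact: IHp sp|exact: IHq sq].
- by case=> y [q [-> fr sp]] /=; apply: free_upd fr; exact: IH sp.
- by case=> y [q [-> fr sp]] /=; apply: free_upd fr; exact: IH sp.
Qed.

Lemma tsubst_fresh s t y u : ~~ tocc y t -> tsubst (upd s y u) t = tsubst s t.
Proof.
by move=> ny; apply: tsubst_ext => x ox; rewrite updN //; apply: contraNneq ny => <-.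
Qed.

(** The factorization of [s12] survives under a quantifier whose variable is renamed from [x] to [y]
    and then to [z], because [y] occurs in no image of another free variable. *)
Lemma upd_comp p s1 s2 s12 x y z :
  (forall w, (w != x) && free w p -> s12 w = tsubst s2 (s1 w)) ->
  (forall w, (w != x) && free w p -> ~~ tocc y (s1 w)) ->
  forall w, free w p ->
    upd s12 x (Var z) w = tsubst (upd s2 y (Var z)) (upd s1 x (Var y) w).
Proof.
move=> e fr w fw; case: (eqVneq w x) => [->|wx]; first by rewrite !updE /= updE.
by rewrite !updN // tsubst_fresh ?e ?fr ?wx.
Qed.

Lemma is_subst_comp s1 s2 s12 phi psi chi :
  (forall x, free x phi -> s12 x = tsubst s2 (s1 x)) ->
  is_subst s1 phi psi -> is_subst s2 psi chi -> is_subst s12 phi chi.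
Proof.
(* The new bound variable [z] avoids the composed images: by [is_subst_free] the variables of [s w]
   are free in [q] and differ from [y], and [z] avoids [s'] on those. *)
have F x y z p q s s' : (forall w, (w != x) && free w p -> ~~ tocc y (s w)) ->
    (forall w, (w != y) && free w q -> ~~ tocc z (s' w)) ->
    is_subst (upd s x (Var y)) p q ->
    forall w, (w != x) && free w p -> ~~ tocc z (tsubst s' (s w)).
  move=> f1 f2 sp w fw; apply/negP => /tocc_tsubst[v ov oz].
  suff /f2 : (v != y) && free v q by rewrite oz.
  have -> /= : v != y by apply: contraTneq ov => ->; exact: f1.
  case/andP: fw => wx fw; apply/(is_subst_free sp); exists w => //.
  by rewrite updN.
elim: phi psi chi s1 s2 s12 => /= [||t u|r ts|p IH|p IHp q IHq|p IHp q IHq|x p IH|x p IH]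
  psi chi s1 s2 s12 e.
- by move=> ->.
- by move=> ->.
- move=> -> /= ->; rewrite !tsubst_comp; congr Eq; apply: tsubst_ext => x ox;
  by rewrite e // ox ?orbT.
- move=> -> /= ->; congr Rel; apply/ffunP => i; rewrite !ffunE tsubst_comp.
  by apply: tsubst_ext => x ox; rewrite e //; apply/existsP; exists i.
- by case=> p' -> sp /= [p'' -> sp']; exists p'' => //; exact: IH e sp sp'.
- case=> p' [q' [-> sp sq]] /= [p'' [q'' [-> sp' sq']]]; exists p'', q''; split=> //.
    by apply: IHp sp sp' => x fx; rewrite e ?fx.
  by apply: IHq sq sq' => x fx; rewrite e ?fx ?orbT.
- case=> p' [q' [-> sp sq]] /= [p'' [q'' [-> sp' sq']]]; exists p'', q''; split=> //.
    by apply: IHp sp sp' => x fx; rewrite e ?fx.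
  by apply: IHq sq sq' => x fx; rewrite e ?fx ?orbT.
- case=> y [q [-> fr sp]] /= [z [r [-> fr' sp']]]; exists z, r; split=> // [w fw|].
    by rewrite e //; exact: F fr fr' sp w fw.
  by apply: IH sp sp'; exact: upd_comp.
- case=> y [q [-> fr sp]] /= [z [r [-> fr' sp']]]; exists z, r; split=> // [w fw|].
    by rewrite e //; exact: F fr fr' sp w fw.
  by apply: IH sp sp'; exact: upd_comp.
Qed.

(** Cancellation: every free variable of [psi] occurs in [s1 x] for some [x] free in [phi], so [s12]
    controls [s2] there. With [s12 = s1] and [s2 = Var], any two results of one substitution are
    alpha-equivalent. *)
Lemma is_subst_div s1 s2 s12 phi psi chi :
  (forall x, free x phi -> s12 x = tsubst s2 (s1 x)) ->
  is_subst s1 phi psi -> is_subst s12 phi chi -> is_subst s2 psi chi.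
Proof.
have F x y z p q s s' s'' : (forall w, (w != x) && free w p -> s'' w = tsubst s' (s w)) ->
    (forall w, (w != x) && free w p -> ~~ tocc z (s'' w)) ->
    is_subst (upd s x (Var y)) p q ->
    forall w, (w != y) && free w q -> ~~ tocc z (s' w).
  move=> e f2 sp w /andP[wy /(is_subst_free sp)[v fv]].
  case: (eqVneq v x) => [->|vx]; first by rewrite updE /= (negPf wy).
  rewrite updN // => ow; apply/negP => oz.
  have /(f2 v)/negP : (v != x) && free v p by rewrite vx.
  by rewrite e ?vx //; apply; apply/tocc_tsubst; exists w.
elim: phi psi chi s1 s2 s12 => /= [||t u|r ts|p IH|p IHp q IHq|p IHp q IHq|x p IH|x p IH]
  psi chi s1 s2 s12 e.
- by move=> ->.
- by move=> ->.
- move=> -> ->; rewrite /= !tsubst_comp; congr Eq; apply: tsubst_ext => x ox;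
  by rewrite e // ox ?orbT.
- move=> -> ->; congr Rel; apply/ffunP => i; rewrite !ffunE tsubst_comp.
  by apply: tsubst_ext => x ox; rewrite e //; apply/existsP; exists i.
- by case=> p' -> sp /= [p'' -> sp']; exists p'' => //; exact: IH e sp sp'.
- case=> p' [q' [-> sp sq]] /= [p'' [q'' [-> sp' sq']]]; exists p'', q''; split=> //.
    by apply: IHp sp sp' => x fx; rewrite e ?fx.
  by apply: IHq sq sq' => x fx; rewrite e ?fx ?orbT.
- case=> p' [q' [-> sp sq]] /= [p'' [q'' [-> sp' sq']]]; exists p'', q''; split=> //.
    by apply: IHp sp sp' => x fx; rewrite e ?fx.
  by apply: IHq sq sq' => x fx; rewrite e ?fx ?orbT.
- case=> y [q [-> fr sp]] /= [z [r [-> fr' sp']]]; exists z, r; split=> //.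
    exact: F e fr' sp.
  by apply: IH sp sp'; exact: upd_comp.
- case=> y [q [-> fr sp]] /= [z [r [-> fr' sp']]]; exists z, r; split=> //.
    exact: F e fr' sp.
  by apply: IH sp sp'; exact: upd_comp.
Qed.

Lemma free_for_Var x phi : free_for (Var x) x phi.
Proof.
elim: phi => //= [p -> q ->|p -> q ->|y p ->|y p ->] //; rewrite andbT eq_sym;
by case: eqP => //=; rewrite orbT.
Qed.

Lemma free_for_notfree t x phi : ~~ free x phi -> free_for t x phi.
Proof.
by elim: phi => //= [p IHp q IHq|p IHp q IHq|y p _ ->|y p _ ->] //;
  rewrite negb_or => /andP[/IHp-> /IHq->].
Qed.

Lemma free_occ x phi : free x phi -> occ x phi.
Proof.
by elim: phi => //= [p IHp q IHq|p IHp q IHq|y p IH|y p IH];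
  [move=> /orP[/IHp->|/IHq->]|move=> /orP[/IHp->|/IHq->]|
   move=> /andP[_ /IH->]|move=> /andP[_ /IH->]]; rewrite ?orbT.
Qed.

Lemma bound_occ x phi : bound x phi -> occ x phi.
Proof.
by elim: phi => //= [p IHp q IHq|p IHp q IHq|y p IH|y p IH];
  [move=> /orP[/IHp->|/IHq->]|move=> /orP[/IHp->|/IHq->]|
   move=> /orP[->|/IH->]|move=> /orP[->|/IH->]]; rewrite ?orbT.
Qed.

Lemma free_for_fresh y x phi : ~~ occ y phi -> free_for (Var y) x phi.
Proof.
by move=> ny; apply: free_for_bound => z /= /eqP->; apply: contraNN ny; exact: bound_occ.
Qed.

Lemma is_subst_subst s phi :
  (forall x, free_for (s x) x phi) -> is_subst s phi (subst s phi).
Proof.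
(* Passing under a quantifier over [y]: variables not free in the body admit every term, and [y]
   itself is now sent to [y]. *)
have Q y p s' : (forall x, ~~ ((x != y) && free x p) ||
      (~~ tocc y (s' x) && free_for (s' x) x p)) ->
    (forall z, (z != y) && free z p -> ~~ tocc y (s' z)) /\
    (forall x, free_for (upd s' y (Var y) x) x p).
  move=> h; split=> [z fz|x]; first by have := h z; rewrite fz /= => /andP[].
  case: (eqVneq x y) => [->|xy]; first by rewrite updE free_for_Var.
  rewrite updN //; have := h x; rewrite xy /=.
  by case: (boolP (free x p)) => [_ /= /andP[]//|/free_for_notfree].
elim: phi s => /= [||t u|r ts|p IH|p IHp q IHq|p IHp q IHq|x p IH|x p IH] s ff //.
- by exists (subst s p) => //; exact: IH.
- exists (subst s p), (subst s q); split=> //.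
    by apply: IHp => x; have /andP[] := ff x.
  by apply: IHq => x; have /andP[] := ff x.
- exists (subst s p), (subst s q); split=> //.
    by apply: IHp => x; have /andP[] := ff x.
  by apply: IHq => x; have /andP[] := ff x.
- have [fr ff'] := Q _ _ _ ff.
  by exists x, (subst (upd s x (Var x)) p); split=> //; exact: IH.
- have [fr ff'] := Q _ _ _ ff.
  by exists x, (subst (upd s x (Var x)) p); split=> //; exact: IH.
Qed.

Lemma is_subst_subst1 x t phi :
  free_for t x phi -> is_subst (upd Var x t) phi (subst1 x t phi).
Proof.
move=> ff; apply: is_subst_subst => y; rewrite /upd.
by case: eqP => [->//|_]; exact: free_for_Var.
Qed.

Lemma subst_Var phi : subst Var phi = phi.
Proof.
elim: phi => /= [||t u|r ts|p ->|p -> q ->|p -> q ->|x p IH|x p IH] //;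
  rewrite ?upd_Var ?IH // ?tsubst_Var //.
by congr Rel; apply/ffunP => i; rewrite ffunE tsubst_Var.
Qed.

Lemma subst1_id x phi : subst1 x (Var x) phi = phi.
Proof. by rewrite /subst1 upd_Var subst_Var. Qed.

Lemma is_subst_refl phi : is_subst Var phi phi.
Proof. by rewrite -{2}(subst_Var phi); apply: is_subst_subst => x; exact: free_for_Var. Qed.

Lemma is_subst_sym phi psi : is_subst Var phi psi -> is_subst Var psi phi.
Proof. by move=> h; apply: is_subst_div h (is_subst_refl phi) => x. Qed.

Lemma is_subst_trans phi psi chi :
  is_subst Var phi psi -> is_subst Var psi chi -> is_subst Var phi chi.
Proof. by apply: is_subst_comp => x. Qed.

Lemma alpha_is_subst phi psi : alpha phi psi -> is_subst Var phi psi.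
Proof.
have B p q x : is_subst Var p q ->
    (forall z, (z != x) && free z p -> ~~ tocc x (Var z : term S)) /\
    is_subst (upd Var x (Var x)) p q.
  by rewrite upd_Var => h; split=> // z /andP[]; rewrite /= eq_sym.
have R x y p : ~~ occ y p ->
    (forall z, (z != x) && free z p -> ~~ tocc y (Var z : term S)) /\
    is_subst (upd Var x (Var y)) p (subst1 x (Var y) p).
  move=> ny; split=> [z /andP[_ /free_occ oz]|].
    by apply: contraNN ny => /= /eqP->.
  by apply: is_subst_subst1; exact: free_for_fresh.
elim=> {phi psi} /=.
- exact: is_subst_refl.
- by move=> p q _; exact: is_subst_sym.
- by move=> p q r _ h _; exact: is_subst_trans.
- by move=> p p' _ h; exists p'.
- by move=> p p' q q' _ hp _ hq; exists p', q'.
- by move=> p p' q q' _ hp _ hq; exists p', q'.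
- by move=> x p p' _ h; have [a b] := B _ _ x h; exists x, p'.
- by move=> x p p' _ h; have [a b] := B _ _ x h; exists x, p'.
- by move=> x y p h; have [a b] := R x _ _ h; exists y, (subst1 x (Var y) p).
- by move=> x y p h; have [a b] := R x _ _ h; exists y, (subst1 x (Var y) p).
Qed.

Lemma free_is_subst_bound s phi :
  exists N, forall z w, free z phi -> tocc w (s z) -> w < N.
Proof.
have [M oM] := occ_bound phi.
have [N hN] := fin_bound (fun i : 'I_M => tocc_bound (s i)).
exists N => z w /free_occ /oM zM ow; apply: hN.
by apply/existsP; exists (Ordinal zM).
Qed.

(** In an alpha-variant whose bound variables lie above all variables of the relevant images, the
    literal [subst] captures nothing. *)
Lemma is_subst_exists s phi : exists psi, is_subst s phi psi.
Proof.
have [N hN] := free_is_subst_bound s phi.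
have [psi /alpha_is_subst a b] := alpha_avoid N phi.
exists (subst s psi); apply: is_subst_comp (a) (is_subst_subst _) => // x.
case: (boolP (free x psi)) => [fx|]; last exact: free_for_notfree.
apply: free_for_bound => y oy; apply/negP => /b; rewrite leqNgt => /negP; apply.
apply: hN oy; apply/(is_subst_free (is_subst_sym a)); exists x => //=; exact: eqxx.
Qed.

(** Brings two results for the same quantified formula, with different bound variables, to a common
    fresh one. *)
Lemma is_subst_rename s x y z p q :
  (forall w, free w (All x p) -> ~~ tocc y (s w)) -> ~~ occ z q ->
  is_subst (upd s x (Var y)) p q -> is_subst (upd s x (Var z)) p (subst1 y (Var z) q).
Proof.
move=> fr nz h; apply: is_subst_comp h (is_subst_subst1 (free_for_fresh y nz)).
by apply: upd_comp => // w _; rewrite tsubst_Var.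
Qed.

End Substitution.

(** * Definedness formulas commute with variable substitutions up to alpha *)

Section Definedness.
Variables (S : signature) (delta : isdef S) (rho : renaming delta).
Implicit Types (t u : term S) (p q r phi psi chi : formula S) (x y z : var).
Implicit Types s : var -> term S.

Lemma is_subst_conj s (I : Type) (F F' : I -> formula S) (l : seq I) :
  (forall i, is_subst s (F i) (F' i)) -> is_subst s (conj (map F l)) (conj (map F' l)).
Proof.
move=> h; case: l => [//|i l] /=.
elim: l {i}(F i) (F' i) (h i) => [//|j l IH] p q spq /=.
by apply: IH; exists q, (F' j).
Qed.

Lemma free_conj z (I : Type) (F : I -> formula S) (l : seq I) :
  free z (conj (map F l)) -> exists i, free z (F i).
Proof.
case: l => [//|i l] /=.
have : free z (F i) -> exists i, free z (F i) by exists i.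
elim: l {i}(F i) => [//|j l IH] p hp /=; apply: IH => /= /orP[//|fz].
by exists j.
Qed.

(** Writing the conjuncts as a family indexed by an option type, with [None] for the isdef conjunct,
    makes the lemmas on [conj (map F l)] applicable. *)
Lemma tDef_App f (ts : {ffun 'I_(farity f) -> term S}) :
  tDef rho (App f ts) =
  conj (map (oapp (fun i => tDef rho (ts i)) (delta_at rho ts))
            (rcons (map Some (enum 'I_(farity f))) None)).
Proof. by rewrite map_rcons -map_comp. Qed.

(** Whatever renaming was chosen, the result is a substitution instance of [delta f] itself, hence
    determined up to bound variables. *)
Lemma delta_at_is_subst f (ts : {ffun 'I_(farity f) -> term S}) s :
  (forall i : 'I_(farity f), s i = ts i) -> is_subst s (delta f) (delta_at rho ts).
Proof.
move=> e; pose s' x := if [pick i : 'I_(farity f) | nat_of_ord i == x] is Some i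
  then ts i else Var x.
have h : is_subst s' (delta f) (delta_at rho ts).
  apply: is_subst_comp (alpha_is_subst (renamed_alpha rho ts)) (is_subst_subst _) => // x.
  rewrite /s'; case: pickP => [i /eqP<-|_]; first exact: renamed_free_for.
  exact: free_for_Var.
apply: is_subst_ext h => x /delta_free lx; rewrite /s'.
case: pickP => [i /eqP<-|/(_ (Ordinal lx))]; first by rewrite e.
by rewrite eqxx.
Qed.

Definition args n (ts : 'I_n -> term S) x : term S :=
  if insub x is Some i then ts i else Var x.

Lemma argsE n (ts : 'I_n -> term S) (i : 'I_n) : args ts i = ts i.
Proof. by rewrite /args valK. Qed.

Lemma free_delta_at f (ts : {ffun 'I_(farity f) -> term S}) z :
  free z (delta_at rho ts) -> tocc z (App f ts).
Proof.
move=> /(is_subst_free (delta_at_is_subst (argsE ts)))[v /delta_free lv].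
have -> : v = Ordinal lv :> nat by [].
by rewrite argsE => oz; apply/existsP; exists (Ordinal lv).
Qed.

(** Both formulas are instances of [delta f], so cancellation relates them. *)
Lemma is_subst_delta_at s f (ts : {ffun 'I_(farity f) -> term S}) :
  is_subst s (delta_at rho ts) (delta_at rho [ffun i => tsubst s (ts i)]).
Proof.
apply: is_subst_div (delta_at_is_subst (argsE ts)) (delta_at_is_subst (argsE _)).
move=> x /delta_free lx.
have -> : x = Ordinal lx :> nat by [].
by rewrite !argsE ffunE.
Qed.

Lemma free_tDef z t : free z (tDef rho t) -> tocc z t.
Proof.
elim/term_induction: t => // f ts IH; rewrite tDef_App => /free_conj[[i|]].
  by move=> /= /IH oz; apply/existsP; exists i.
exact: free_delta_at.
Qed.

(** For these substitutions [Def] commutes with substitution: where [tDef] of a variable is [Tru],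
    [tDef] of its image is [Tru] as well. Variable renamings qualify, and updating by a variable
    preserves the property. *)
Definition total_subst s := forall x, tDef rho (s x) = Tru.

Lemma total_subst_Var (sg : var -> var) : total_subst (fun x => Var (sg x)).
Proof. by []. Qed.

Lemma total_subst_upd s x y : total_subst s -> total_subst (upd s x (Var y)).
Proof. by move=> ts z; rewrite /upd; case: eqP. Qed.

Lemma is_subst_tDef s t : total_subst s -> is_subst s (tDef rho t) (tDef rho (tsubst s t)).
Proof.
move=> tot; elim/term_induction: t => [x|//|f ts IH]; first by rewrite /= tot.
rewrite [tsubst _ _]/= !tDef_App; apply: is_subst_conj => -[i|] /=; last exact: is_subst_delta_at.
by rewrite ffunE.
Qed.

Lemma free_Def z phi : free z (Def rho phi) -> free z phi.
Proof.
elim: phi => //= [t u|r ts|p IHp q IHq|p IHp q IHq|x p IH|x p IH].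
- by move=> /orP[] /free_tDef->; rewrite ?orbT.
- by move=> /free_conj[i] /free_tDef oz; apply/existsP; exists i.
- by case/orP=> [/orP[]|] /orP[] => [/IHp|/IHq|/IHp||/IHq|] ->; rewrite ?orbT.
- by case/orP=> [/orP[]|] /orP[] => [/IHp|/IHq|/IHp||/IHq|] ->; rewrite ?orbT.
- by case/orP=> /andP[-> /=] => [/IH|/orP[/IH|]].
- by case/orP=> /andP[-> /=] => [/IH|/orP[/IH|]].
Qed.

(** [Def phi] has no free variables beyond those of [phi], so the bound variable of [psi] is still
    fresh for the quantifiers that [Def] introduces. *)
Lemma is_subst_Def s phi psi : total_subst s ->
  is_subst s phi psi -> is_subst s (Def rho phi) (Def rho psi).
Proof.
elim: phi psi s => /= [||t u|r ts|p IH|p IHp q IHq|p IHp q IHq|x p IH|x p IH] psi s tot.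
- by move=> ->.
- by move=> ->.
- by move=> -> /=; do 2!eexists; split; first reflexivity; exact: is_subst_tDef.
- by move=> -> /=; apply: is_subst_conj => i; rewrite ffunE; exact: is_subst_tDef.
- by case=> p' -> /IH; apply.
- case=> p' [q' [-> sp sq]] /=; have [dp dq] := (IHp _ _ tot sp, IHq _ _ tot sq).
  by do ![eexists; eexists; split; first reflexivity]; do ?eexists.
- case=> p' [q' [-> sp sq]] /=; have [dp dq] := (IHp _ _ tot sp, IHq _ _ tot sq).
  by do ![eexists; eexists; split; first reflexivity]; do ?eexists.
- case=> y [q [-> fr sp]] /=; have dp := IH _ _ (total_subst_upd x y tot) sp.
  exists (All y (Def rho q)), (Ex y (And (Def rho q) (Neg q))); split=> //.
    exists y, (Def rho q); split=> // z /andP[zx /free_Def fz].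
    by apply: fr; rewrite zx.
  exists y, (And (Def rho q) (Neg q)); split=> // [z /andP[zx fz]|].
    by apply: fr; rewrite zx; case/orP: fz => [/free_Def|].
  by exists (Def rho q), (Neg q); split=> //; exists q.
- case=> y [q [-> fr sp]] /=; have dp := IH _ _ (total_subst_upd x y tot) sp.
  exists (All y (Def rho q)), (Ex y (And (Def rho q) q)); split=> //.
    exists y, (Def rho q); split=> // z /andP[zx /free_Def fz].
    by apply: fr; rewrite zx.
  exists y, (And (Def rho q) q); split=> // [z /andP[zx fz]|].
    by apply: fr; rewrite zx; case/orP: fz => [/free_Def|].
  by exists (Def rho q), q.
Qed.

End Definedness.

(** * Derived rules of the calculus *)

Section Derivations.
Variables (S : signature) (delta : isdef S) (rho : renaming delta).
Implicit Types (t u : term S) (p q r phi psi chi : formula S) (x y z : var).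
Implicit Types (s : var -> term S) (G D : set (formula S)).

Local Notation "G |- p" := (provable rho G p) (at level 75, p at level 70).
Local Notation Def := (Def rho).
Local Notation tDef := (tDef rho).

Lemma weaken G D p : G `<=` D -> G |- p -> D |- p.
Proof. by move=> /setUidr<-; exact: P2. Qed.

Lemma assumption G p : G p -> G |- p.
Proof. by move=> Gp; apply: weaken (P1 rho p) => q ->. Qed.

Lemma weakenU G p q : G |- q -> G `|` [set p] |- q.
Proof. by apply: weaken => r; left. Qed.

Lemma assumptionU G p : G `|` [set p] |- p.
Proof. by apply: assumption; right. Qed.

Lemma derive1 p q G : [set p] |- q -> G |- p -> G |- q.
Proof. by move=> pq Gp; apply: P3 Gp _; apply: weaken pq => r ->; right. Qed.

Lemma derive2 p q r G : [set p; q] |- r -> G |- p -> G |- q -> G |- r.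
Proof.
move=> pqr Gp Gq; apply: (P3 Gp); apply: (P3 (weakenU _ Gq)).
by apply: weaken pqr => _ [->|->]; [left; right|right].
Qed.

Lemma weaken0 G p : set0 |- p -> G |- p.
Proof. by apply: weaken => q. Qed.

Lemma derive_And G p q : G |- p -> G |- q -> G |- And p q.
Proof. exact: derive2 (AndI rho p q). Qed.

Lemma derive_And1 G p q : G |- And p q -> G |- p.
Proof. exact: derive1 (AndE1 rho p q). Qed.

Lemma derive_And2 G p q : G |- And p q -> G |- q.
Proof. exact: derive1 (AndE2 rho p q). Qed.

Lemma derive_Or1 G p q : G |- p -> G |- Or p q.
Proof. exact: derive1 (OrI1 rho p q). Qed.

Lemma derive_Or2 G p q : G |- q -> G |- Or p q.
Proof. exact: derive1 (OrI2 rho p q). Qed.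

Lemma derive_Def G p : G |- p -> G |- Def p.
Proof. exact: derive1 (D1 rho p). Qed.

Lemma cases G p q r :
  G |- Or p q -> G `|` [set p] |- r -> G `|` [set q] |- r -> G |- r.
Proof. by move=> Gpq Gpr Gqr; apply: (P3 Gpq); exact: OrE. Qed.

Lemma contradiction G p q : G |- p -> G |- Neg p -> G |- q.
Proof. by move=> Gp Gnp; apply: derive1 (C2 rho q) _; exact: derive2 (C3 rho p) Gp Gnp. Qed.

(** C1 read as a case distinction between true, false and undefined. *)
Lemma excluded_fourth G p q :
  G `|` [set p] |- q -> G `|` [set Neg p] |- q -> G `|` [set Neg (Def p)] |- q -> G |- q.
Proof.
move=> h1 h2 h3; apply: cases (weaken0 G (C1 rho p)) _ h3.
apply: cases (assumptionU _ _) _ _.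
  by apply: weaken h1 => r [|]; [left; left|right].
by apply: weaken h2 => r [|]; [left; left|right].
Qed.

Lemma excluded_middle G p q :
  G |- Def p -> G `|` [set p] |- q -> G `|` [set Neg p] |- q -> G |- q.
Proof.
move=> Gd h1 h2; apply: excluded_fourth h1 h2 _.
exact: contradiction (weakenU _ Gd) (assumptionU _ _).
Qed.

(** Proof by contradiction needs [Def p], since a contradictory [p] may be undefined instead of
    false. *)
Lemma derive_Neg G p : G |- Def p -> G `|` [set p] |- Fls -> G |- Neg p.
Proof.
move=> Gd h; apply: (excluded_middle Gd) (assumptionU _ _).
exact: derive1 (C2 rho _) h.
Qed.

(** No rule introduces [Tru], but it is its own definedness formula: in the two negative cases of
    C1, D1 applied to [Neg Tru] gives [Def (Neg Tru)], which is [Tru]. *)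
Lemma derive_Tru G : G |- Tru.
Proof.
apply: weaken0; apply: (@excluded_fourth _ Tru); first exact: assumptionU.
  exact: derive_Def (assumptionU _ _).
exact: derive_Def (assumptionU _ _).
Qed.

Lemma derive_conj G (I : eqType) (F : I -> formula S) (l : seq I) :
  G |- conj (map F l) <-> forall i, i \in l -> G |- F i.
Proof.
case: l => [|i l]; first by split=> // _; exact: derive_Tru.
rewrite /=; have E j : j \in i :: l <-> j = i \/ j \in l.
  by rewrite inE; split=> [/orP[/eqP|]|[->|->]]; rewrite ?eqxx ?orbT; auto.
suff -> : G |- foldl (@And S) (F i) (map F l) <->
    G |- F i /\ forall j, j \in l -> G |- F j.
  by split=> [[Gi Gl] j /E[->|/Gl]|h]; last by split=> [|j jl]; apply: h; apply/E; auto.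
elim: l (F i) {E} => [|k l IH] p /=; first by split=> [|[]].
rewrite IH; split=> [[Gpk Gl]|[Gp Gl]].
  split=> [|j]; first exact: derive_And1 Gpk.
  by rewrite inE => /orP[/eqP->|/Gl//]; exact: derive_And2 Gpk.
split=> [|j jl]; last by apply: Gl; rewrite inE jl orbT.
by apply: derive_And Gp _; apply: Gl; rewrite inE eqxx.
Qed.

Lemma derive_tDef_App G f (ts : {ffun 'I_(farity f) -> term S}) :
  G |- tDef (App f ts) <-> (forall i, G |- tDef (ts i)) /\ G |- delta_at rho ts.
Proof.
rewrite tDef_App derive_conj; split=> [h|[h1 h2] [i|] _].
- split=> [i|]; last by apply: (h None); rewrite mem_rcons inE.
  by apply: (h (Some i)); rewrite mem_rcons inE /= (mem_map (@Some_inj _)) mem_enum.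
- exact: h1.
- exact: h2.
Qed.

Lemma derive_Def_Rel G (R : rel_sym S) (ts : {ffun 'I_(rarity R) -> term S}) :
  G |- Def (Rel R ts) <-> forall i, G |- tDef (ts i).
Proof.
rewrite /= derive_conj; split=> h i; last by move=> _; exact: h.
by apply: h; rewrite mem_enum.
Qed.

Lemma derive_AllE G x y p : ~~ occ y p -> G |- All x p -> G |- subst1 x (Var y) p.
Proof.
move=> ny; apply: derive2 (derive_Tru _).
exact: (AllE rho (free_for_fresh x ny)).
Qed.

Lemma derive_AllE_id G x p : G |- All x p -> G |- p.
Proof.
move=> h; rewrite -(subst1_id x p).
exact: derive2 (AllE rho (free_for_Var x p)) (derive_Tru _) h.
Qed.

Lemma derive_ExI G x t p : free_for t x p -> G |- subst1 x t p -> G |- Ex x p.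
Proof. by move=> ff; exact: derive1 (ExI rho ff). Qed.

Lemma derive_ExI_id G x p : G |- p -> G |- Ex x p.
Proof.
by move=> h; apply: (@derive_ExI _ _ (Var x)); rewrite ?free_for_Var ?subst1_id.
Qed.

End Derivations.

(** * Alpha-equivalent formulas are interderivable *)

Section Alpha.
Variables (S : signature) (delta : isdef S) (rho : renaming delta).
Implicit Types (t u : term S) (p q r phi psi chi : formula S) (x y z : var).
Implicit Types (s : var -> term S) (G D : set (formula S)).

Local Notation "G |- p" := (provable rho G p) (at level 75, p at level 70).
Local Notation Def := (Def rho).
Local Notation tDef := (tDef rho).
Local Notation total_subst := (total_subst rho).

Lemma subst_back s1 s2 z q : ~~ occ z q ->
  (forall x, occ x q -> s1 x = Var x /\ s2 x = Var x \/ s1 x = Var z /\ s2 z = Var x) ->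
  subst s2 (subst s1 q) = q.
Proof.
have T s1' s2' t : (forall x, tocc x t -> s1' x = Var x /\ s2' x = Var x \/
    s1' x = Var z /\ s2' z = Var x) -> tsubst s2' (tsubst s1' t) = t.
  move=> h; rewrite tsubst_comp -[RHS]tsubst_Var; apply: tsubst_ext => x /h.
  by case=> -[-> /= ->].
have Q s1' s2' y p : ~~ ((z == y) || occ z p) ->
    (forall x, (x == y) || occ x p -> s1' x = Var x /\ s2' x = Var x \/
      s1' x = Var z /\ s2' z = Var x) ->
    ~~ occ z p /\ forall x, occ x p ->
      upd s1' y (Var y) x = Var x /\ upd s2' y (Var y) x = Var x \/
      upd s1' y (Var y) x = Var z /\ upd s2' y (Var y) z = Var x :> term S.
  rewrite negb_or => /andP[zy nz] h; split=> // x ox.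
  rewrite /upd (negPf zy); case: eqP => [->|_]; first by left.
  by apply: h; rewrite ox orbT.
elim: q s1 s2 => /= [||t u|R ts|p IH|p IHp q IHq|p IHp q IHq|x p IH|x p IH] s1 s2 nz h //.
- by rewrite !T // => x ox; apply: h; rewrite ox ?orbT.
- congr Rel; apply/ffunP => i; rewrite !ffunE T // => x ox; apply: h.
  by apply/existsP; exists i.
- by rewrite IH.
- move: nz; rewrite negb_or => /andP[np nq].
  by rewrite IHp ?IHq // => x ox; apply: h; rewrite ox ?orbT.
- move: nz; rewrite negb_or => /andP[np nq].
  by rewrite IHp ?IHq // => x ox; apply: h; rewrite ox ?orbT.
- by have [nz' h'] := Q _ _ _ _ nz h; rewrite IH.
- by have [nz' h'] := Q _ _ _ _ nz h; rewrite IH.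
Qed.

Lemma subst1_back y z q : ~~ occ z q -> subst1 z (Var y) (subst1 y (Var z) q) = q.
Proof.
move=> nz; apply: (subst_back nz) => x ox.
have xz : x != z by apply: contraTneq ox => ->.
rewrite /upd eqxx (negPf xz); case: eqP => [->|_]; first by right.
by left.
Qed.

Lemma subst_Var_ext s q : (forall x, occ x q -> s x = Var x) -> subst s q = q.
Proof.
move=> h; have [N oN] := occ_bound q.
rewrite -[RHS](@subst_back s Var N) ?subst_Var //.
  by apply/negP => /oN; rewrite ltnn.
by move=> x ox; left; rewrite h.
Qed.

(** [z] stands only where [y] was free, thus never below a quantifier over [y]. *)
Lemma free_for_back y z q : ~~ occ z q -> free_for (Var y) z (subst1 y (Var z) q).
Proof.
rewrite /subst1; set s := upd _ _ _.
have : forall x, x != y -> s x = Var x by move=> x xy; rewrite /s updN.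
have Q x p s' : (forall w, w != y -> s' w = Var w) -> ~~ ((z == x) || occ z p) ->
    (~~ occ z p -> (forall w, w != y -> upd s' x (Var x) w = Var w) ->
      free_for (Var y) z (subst (upd s' x (Var x)) p)) ->
    ~~ ((z != x) && free z (subst (upd s' x (Var x)) p)) ||
    (x != y) && free_for (Var y) z (subst (upd s' x (Var x)) p).
  rewrite negb_or => e /andP[zx nz] IH.
  case: (eqVneq x y) => [xy|xy] /=; last first.
    by rewrite IH ?orbT // => w wy; rewrite /upd; case: eqP => [->|_] //; exact: e.
  rewrite orbF negb_and subst_Var_ext ?(contraNN (@free_occ _ _ _) nz) ?orbT //.
  by move=> w _; rewrite /upd; case: eqP => [->//|/eqP wx]; apply: e; rewrite -xy.
elim: q s => /= [||t u|R ts|p IH|p IHp q IHq|p IHp q IHq|x p IH|x p IH] s e nz //.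
- exact: IH.
- by move: nz; rewrite negb_or => /andP[np nq]; rewrite IHp ?IHq.
- by move: nz; rewrite negb_or => /andP[np nq]; rewrite IHp ?IHq.
- by apply: Q => // nz' e'; exact: IH.
- by apply: Q => // nz' e'; exact: IH.
Qed.

Lemma fresh_var p : exists z, ~~ occ z p.
Proof. by have [N oN] := occ_bound p; exists N; apply/negP => /oN; rewrite ltnn. Qed.

(* Stability is closed under all connectives except negation, where the
   definedness formula intervenes; this is why it is established together
   with that of [Def phi]. *)
Definition stable phi := forall s psi psi',
  total_subst s -> is_subst s phi psi -> is_subst s phi psi' -> [set psi] |- psi'.

Lemma stable_atomic phi :
  (forall s psi psi', is_subst s phi psi -> is_subst s phi psi' -> psi = psi') ->
  stable phi.
Proof. by move=> h s psi psi' _ h1 h2; rewrite (h _ _ _ h1 h2); exact: P1. Qed.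

Lemma stable_Tru : stable Tru.
Proof. by apply: stable_atomic => s _ _ -> ->. Qed.

Lemma stable_And p q : stable p -> stable q -> stable (And p q).
Proof.
move=> hp hq s _ _ tot [p1 [q1 [-> sp1 sq1]]] [p2 [q2 [-> sp2 sq2]]].
apply: derive_And.
  exact: derive1 (hp _ _ _ tot sp1 sp2) (AndE1 _ _ _).
exact: derive1 (hq _ _ _ tot sq1 sq2) (AndE2 _ _ _).
Qed.

Lemma stable_Or p q : stable p -> stable q -> stable (Or p q).
Proof.
move=> hp hq s _ _ tot [p1 [q1 [-> sp1 sq1]]] [p2 [q2 [-> sp2 sq2]]].
apply: (cases (P1 _ _)).
  by apply: derive_Or1; exact: derive1 (hp _ _ _ tot sp1 sp2) (assumptionU _ _ _).
by apply: derive_Or2; exact: derive1 (hq _ _ _ tot sq1 sq2) (assumptionU _ _ _).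
Qed.

(** D1 turns [Neg p1] into [Def p1], hence into [Def p2]; then [p2] can be refuted by contradiction,
    as it would give [p1]. *)
Lemma stable_Neg p : stable p -> stable (Def p) -> stable (Neg p).
Proof.
move=> hp hd s _ _ tot [p1 -> sp1] [p2 -> sp2].
apply: derive_Neg.
  apply: derive1 (hd _ _ _ tot (is_subst_Def tot sp1) (is_subst_Def tot sp2)) _.
  exact: (derive_Def (P1 rho (Neg p1))).
apply: (@contradiction _ _ _ _ p1); last exact: weakenU (P1 _ _).
exact: derive1 (hp _ _ _ tot sp2 sp1) (assumptionU _ _ _).
Qed.

Lemma stable_All x p : stable p -> stable (All x p).
Proof.
move=> hp s _ _ tot [y1 [p1 [-> fr1 sp1]]] [y2 [p2 [-> fr2 sp2]]].
have [z] := fresh_var (And (All y1 p1) (All y2 p2)).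
rewrite /= !negb_or -!andbA => /and4P[zy1 zp1 zy2 zp2].
(* The detour through a [z] fresh for both formulas avoids instantiating [All y1 p1] at [y2], which
   may be bound in [p1]. *)
have h : [set All y1 p1] |- All z (subst1 y2 (Var z) p2).
  apply: AllI => [|_ ->]; last first.
    by rewrite /= negb_and (contraNN (@free_occ _ _ _) zp1) orbT.
  apply: derive1 (derive_AllE zp1 (P1 _ _)).
  by apply: hp (is_subst_rename fr1 zp1 sp1) (is_subst_rename fr2 zp2 sp2); exact: total_subst_upd.
apply: AllI => [|_ ->].
  rewrite -[p2](subst1_back y2 zp2).
  by apply: derive2 (AllE rho (free_for_back y2 zp2)) (derive_Tru _ _) h.
(* Eigenvariable condition: a variable free in [All y1 p1] comes from some [s v] with [v] free in
   [All x p], and [fr2] keeps [y2] out of these. *)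
have sp1' : is_subst s (All x p) (All y1 p1) by exists y1, p1.
apply/negP => /(is_subst_free sp1')[v fv]; exact/negP/fr2.
Qed.

Lemma stable_Ex x p : stable p -> stable (Ex x p).
Proof.
move=> hp s _ _ tot [y1 [p1 [-> fr1 sp1]]] [y2 [p2 [-> fr2 sp2]]].
have [z] := fresh_var (And (Ex y1 p1) (Ex y2 p2)).
rewrite /= !negb_or -!andbA => /and4P[zy1 zp1 zy2 zp2].
rewrite -[X in X |- _]set0U; apply: (@ExE _ _ _ _ _ z) => //=; last 2 first.
- by rewrite negb_or zy1.
- by rewrite negb_or zy2.
rewrite set0U; apply: derive_ExI (free_for_fresh y2 zp2) _.
by apply: hp (is_subst_rename fr1 zp1 sp1) (is_subst_rename fr2 zp2 sp2); exact: total_subst_upd.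
Qed.

Lemma stable_conj (I : Type) (F : I -> formula S) (l : seq I) :
  (forall i, stable (F i)) -> stable (conj (map F l)).
Proof.
move=> h; case: l => [|i l] /=; first exact: stable_Tru.
by elim: l {i}(F i) (h i) => [//|j l IH] p hp /=; apply: IH; exact: stable_And.
Qed.

Fixpoint all_terms (P : term S -> Prop) phi : Prop :=
  match phi with
  | Fls | Tru => True
  | Eq t u => P t /\ P u
  | Rel r ts => forall i, P (ts i)
  | Neg p => all_terms P p
  | And p q | Or p q => all_terms P p /\ all_terms P q
  | All _ p | Ex _ p => all_terms P p
  end.

Lemma all_termsT (P : term S -> Prop) phi : (forall t, P t) -> all_terms P phi.
Proof. by move=> h; elim: phi => /=. Qed.

(** The assumption is limited to the terms of [phi] because [stable_tDef] applies this to an isdef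
    instance while its own induction on terms is still running. *)
Lemma stable_of_terms phi : all_terms (fun t => stable (tDef t)) phi ->
  stable phi /\ stable (Def phi).
Proof.
elim: phi => /= [||t u|R ts|p IH|p IHp q IHq|p IHp q IHq|x p IH|x p IH].
- by split; apply: stable_atomic => s _ _ -> ->.
- by split; apply: stable_atomic => s _ _ -> ->.
- by move=> [ht hu]; split; [apply: stable_atomic => s _ _ -> ->|exact: stable_And].
- by move=> h; split; [apply: stable_atomic => s _ _ -> ->|exact: stable_conj].
- by move=> /IH[h1 h2]; split=> //; exact: stable_Neg.
- move=> [/IHp[p1 p2] /IHq[q1 q2]]; split; first exact: stable_And.
  by do ![apply: stable_And|apply: stable_Or|apply: stable_Neg].
- move=> [/IHp[p1 p2] /IHq[q1 q2]]; split; first exact: stable_Or.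
  by do ![apply: stable_And|apply: stable_Or|apply: stable_Neg].
- move=> /IH[h1 h2]; split; first exact: stable_All.
  by apply: stable_Or; [exact: stable_All|apply/stable_Ex/stable_And => //; exact: stable_Neg].
- move=> /IH[h1 h2]; split; first exact: stable_Ex.
  by apply: stable_Or; [exact: stable_All|exact/stable_Ex/stable_And].
Qed.

Lemma tfun_occ_tsubst g s t :
  (forall x, ~~ tfun_occ g (s x)) -> tfun_occ g (tsubst s t) = tfun_occ g t.
Proof.
move=> h; elim/term_induction: t => [x|//|f ts IH] /=; first exact/negbTE.
by congr (_ || _); apply: eq_existsb => i; rewrite ffunE.
Qed.

Lemma fun_occ_subst g s phi :
  (forall x, ~~ tfun_occ g (s x)) -> fun_occ g (subst s phi) = fun_occ g phi.
Proof.
elim: phi s => /= [||t u|R ts|p IH|p IHp q IHq|p IHp q IHq|x p IH|x p IH] s h //.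
- by rewrite !tfun_occ_tsubst.
- by apply: eq_existsb => i; rewrite ffunE tfun_occ_tsubst.
- exact: IH.
- by rewrite IHp ?IHq.
- by rewrite IHp ?IHq.
- by apply: IH => y; rewrite /upd; case: eqP.
- by apply: IH => y; rewrite /upd; case: eqP.
Qed.

Lemma fun_occ_alpha g phi psi : alpha phi psi -> fun_occ g phi = fun_occ g psi.
Proof.
elim=> //= {phi psi} [p q r _ -> _ ->|p p' q q' _ -> _ ->|p p' q q' _ -> _ ->|x y p _|x y p _] //;
by rewrite fun_occ_subst // => z; rewrite /upd; case: eqP.
Qed.

(** For [g] with [delta g = Tru] the isdef conjunct is literally [Tru], since substitution leaves
    [Tru] unchanged; only the conjuncts coming from the terms [s x] remain. *)
Lemma stable_tDef_tsubst s t : (forall g, tfun_occ g t -> delta g = Tru) ->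
  (forall x, stable (tDef (s x))) -> stable (tDef (tsubst s t)).
Proof.
move=> + h; elim/term_induction: t => [x|c|f ts IH] triv; first exact: h.
  exact: stable_Tru.
rewrite [tsubst _ _]/= tDef_App; apply: stable_conj => -[i|] /=.
  rewrite ffunE; apply: IH => g og; apply: triv => /=.
  by apply/orP; right; apply/existsP; exists i.
have := delta_at_is_subst rho (argsE [ffun i => tsubst s (ts i)]).
by rewrite triv /= ?eqxx // => ->; exact: stable_Tru.
Qed.

Lemma stable_terms_subst s phi : (forall g, fun_occ g phi -> delta g = Tru) ->
  (forall x, stable (tDef (s x))) ->
  all_terms (fun t => stable (tDef t)) (subst s phi).
Proof.
elim: phi s => /= [||t u|R ts|p IH|p IHp q IHq|p IHp q IHq|x p IH|x p IH] s triv h //.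
- by split; apply: stable_tDef_tsubst h => g og; apply: triv; rewrite og ?orbT.
- move=> i; rewrite ffunE; apply: stable_tDef_tsubst h => g og; apply: triv.
  by apply/existsP; exists i.
- exact: IH.
- by split; [apply: IHp h|apply: IHq h] => g og; apply: triv; rewrite og ?orbT.
- by split; [apply: IHp h|apply: IHq h] => g og; apply: triv; rewrite og ?orbT.
- by apply: IH => // y; rewrite /upd; case: eqP => // _; exact: stable_Tru.
- by apply: IH => // y; rewrite /upd; case: eqP => // _; exact: stable_Tru.
Qed.

(* The terms of [delta_at ts] are built from the ts by function symbols g with
   [delta g = Tru], so that their definedness reduces to that of the ts. *)
Lemma stable_tDef t : stable (tDef t).
Proof.
elim/term_induction: t => [x|c|f ts IH]; [exact: stable_Tru|exact: stable_Tru|].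
rewrite tDef_App; apply: stable_conj => -[i|] //=.
have [] // := @stable_of_terms (delta_at rho ts).
apply: stable_terms_subst => [g|x].
  by rewrite -(fun_occ_alpha _ (renamed_alpha rho ts)); exact: delta_Tru.
by case: pickP => [i _|_]; [exact: IH|exact: stable_Tru].
Qed.

Lemma stableP phi : stable phi.
Proof. by have [] := stable_of_terms (all_termsT phi stable_tDef). Qed.

Lemma derive_alpha G phi psi : is_subst Var phi psi -> G |- phi -> G |- psi.
Proof.
move=> h; apply: derive1.
exact: (@stableP phi Var phi psi (fun=> erefl) (is_subst_refl phi) h).
Qed.

Lemma derive_Def_is_subst G s phi psi chi : total_subst s ->
  is_subst s phi psi -> is_subst s (Def phi) chi -> G |- Def psi <-> G |- chi.
Proof.
by move=> tot /(is_subst_Def tot) h1 h2; split; apply: derive_alpha;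
  [apply: is_subst_div h1 h2|apply: is_subst_div h2 h1] => x _; rewrite tsubst_Var.
Qed.

Lemma alpha_free_for t x phi : exists2 psi, is_subst Var phi psi & free_for t x psi.
Proof.
have [N oN] := tocc_bound t.
have [psi /alpha_is_subst a b] := alpha_avoid N phi; exists psi => //.
by apply: free_for_bound => y /oN ltN; apply/negP => /b; rewrite leqNgt ltN.
Qed.

Lemma is_subst_upd_Var x t p q r : is_subst Var p q -> is_subst (upd Var x t) p r ->
  is_subst (upd Var x t) q r.
Proof. by apply: is_subst_div => y. Qed.

Lemma is_subst_Var_quant x p q : is_subst Var p q ->
  is_subst Var (All x p) (All x q) /\ is_subst Var (Ex x p) (Ex x q).
Proof.
rewrite -{1}(@upd_Var S x) => h; split; exists x, q; split=> // z /andP[];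
by rewrite /= eq_sym.
Qed.

(** The rule without its side condition: pass to an alpha-variant of [q] in which [t] is free for
    [x], and return by alpha-invariance. *)
Lemma derive_AllE_subst G x t q r : is_subst (upd Var x t) q r -> G |- tDef t ->
  G |- All x q -> G |- r.
Proof.
move=> sr Gt Gq; have [q' qq' ff] := alpha_free_for t x q.
apply: derive_alpha (derive2 (AllE rho ff) Gt _); last first.
  by apply: derive_alpha Gq; have [] := is_subst_Var_quant x qq'.
have sr' := is_subst_upd_Var qq' sr.
by apply: is_subst_div (is_subst_subst1 ff) sr' => y _; rewrite tsubst_Var.
Qed.

Lemma derive_ExI_subst G x t q r : is_subst (upd Var x t) q r -> G |- r -> G |- Ex x q.
Proof.
move=> sr Gr; have [q' qq' ff] := alpha_free_for t x q.
apply: (@derive_alpha _ (Ex x q')).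
  by have [] := is_subst_Var_quant x (is_subst_sym qq').
apply: derive_ExI (ff) _; apply: derive_alpha Gr.
have sr' := is_subst_upd_Var qq' sr.
by apply: is_subst_div sr' (is_subst_subst1 ff) => y _; rewrite tsubst_Var.
Qed.

End Alpha.

(** * Compactness, and consistency after doubling the variables *)

Section Consistency.
Variables (S : signature) (delta : isdef S) (rho : renaming delta).
Implicit Types (t u : term S) (p q r phi psi chi : formula S) (x y z : var).
Implicit Types (s : var -> term S) (G D : set (formula S)).

Local Notation "G |- p" := (provable rho G p) (at level 75, p at level 70).
Local Notation Def := (Def rho).
Local Notation tDef := (tDef rho).

(** D1 yields [Def (All x p)]. Its existential disjunct already contains a counterexample. Its other
    disjunct [All x (Def p)] makes [Ex x (Neg p)] defined, and if that were false, every [p] would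
    be true. *)
Lemma Neg_All x p : [set Neg (All x p)] |- Ex x (Neg p).
Proof.
apply: (cases (derive_Def (P1 rho (Neg (All x p))))); last first.
  set G := _ `|` _; have [z nz] := fresh_var (And (Ex x (And (Def p) (Neg p))) (Ex x (Neg p))).
  move: (nz); rewrite /= !negb_or => /andP[/andP[zx /andP[zd zp]] _].
  have h : set0 `|` [set Ex x (And (Def p) (Neg p))] |- Ex x (Neg p).
    apply: (@ExE _ _ _ _ _ z) => //=; rewrite ?negb_or ?zx ?zd ?zp //.
    apply: (@derive_ExI _ _ _ _ _ (Var z)); first exact: free_for_fresh.
    by apply: derive_And2 (assumptionU _ _ _).
  by apply: weaken h => q [//|->]; right.
set G := _ `|` _.
have GD : G |- Def (Ex x (Neg p)) by apply/derive_Or1/assumptionU.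
apply: (excluded_middle GD (assumptionU _ _ _)).
apply: (@contradiction _ _ _ _ (All x p)); last by apply: assumption; left; left.
apply: AllI => [|q]; last first.
  by move=> [[->|->]|->]; rewrite /= eqxx.
apply: (excluded_middle _ (assumptionU _ _ _)).
  by apply: (@derive_AllE_id _ _ _ _ x); apply: assumption; left; right.
apply: (@contradiction _ _ _ _ (Ex x (Neg p))); last exact: weakenU (assumptionU _ _ _).
exact: derive_ExI_id (assumptionU _ _ _).
Qed.

Lemma derive_Neg_All G x p : G |- Neg (All x p) -> G |- Ex x (Neg p).
Proof. exact: derive1 (Neg_All x p). Qed.

(** A refutation of [p] proves only that [p] is false or undefined. This disjunction is generalized
    over [x] and instantiated at [y]; D1 excludes its second half in the presence of [q]. *)
Lemma refutation_subst1 x y p q : is_subst (upd Var x (Var y)) p q ->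
  [set p] |- Fls -> [set q] |- Fls.
Proof.
move=> spq pF.
have h : set0 |- All x (Or (Neg p) (Neg (Def p))).
  apply: AllI => //; apply: (@excluded_fourth _ _ _ _ p).
  - by apply: derive1 (C2 rho _) _; apply: derive1 pF _; exact: assumptionU.
  - by apply: derive_Or1; exact: assumptionU.
  - by apply: derive_Or2; exact: assumptionU.
have [d sd] := is_subst_exists (upd Var x (Var y)) (Def p).
have tot : total_subst rho (upd Var x (Var y)) by exact: total_subst_upd.
have : [set q] |- Or (Neg q) (Neg d).
  apply: derive_AllE_subst (derive_Tru _ _ : _ |- tDef (Var y)) (weaken0 _ h).
  by exists (Neg q), (Neg d); split=> //; [exists q|exists d].
move=> /cases; apply; first exact: contradiction (weakenU _ (P1 _ _)) (assumptionU _ _ _).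
apply: contradiction (assumptionU _ _ _); apply: weakenU.
apply/(derive_Def_is_subst _ tot spq sd); exact: derive_Def (P1 _ _).
Qed.

(* The variables v_(2i) are moved back to v_i one at a time in increasing order:
   when v_(2k) is replaced by v_k, it stands for v_k only. *)
Lemma refutation_double p q : is_subst (fun x => Var x.*2) p q ->
  [set q] |- Fls -> [set p] |- Fls.
Proof.
move=> spq qF; have [N oN] := occ_bound p.
pose h k x : term S := Var (if x < k then x else x.*2).
suff H k r : is_subst (h k) p r -> [set r] |- Fls.
  apply: (H N); apply: is_subst_ext (is_subst_refl p) => x /free_occ /oN ltx.
  by rewrite /h ltx.
elim: k r => [|k IH] r sr.
  have sqr : is_subst Var q r.
    by apply: is_subst_div spq sr => x _; rewrite tsubst_Var.
  apply: derive1 qF _; apply: derive_alpha (P1 _ _); exact: is_subst_sym.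
have [q' sq'] := is_subst_exists (h k) p.
apply: (@refutation_subst1 k.*2 k _ _ _ (IH _ sq')).
apply: is_subst_div sq' sr => x _; rewrite /h /upd /= ltnS.
case: ltngtP => [xk|xk|->]; last by rewrite eqxx.
- have -> // : x == k.*2 = false.
  by apply/negbTE; rewrite neq_ltn (leq_trans xk) // -addnn leq_addr.
- by rewrite (inj_eq double_inj) gtn_eqF.
Qed.

(** Membership is [List.In], which asks for no decidable equality on formulas. *)
Definition finset_of (l : seq (formula S)) : set (formula S) := fun p => List.In p l.

Lemma In_cat p l1 l2 : List.In p (l1 ++ l2) <-> List.In p l1 \/ List.In p l2.
Proof.
elim: l1 => [|q l1 IH] /=; first by split; [right|case].
by rewrite IH; tauto.
Qed.

Lemma compactness G p : G |- p ->
  exists2 l, (forall q, List.In q l -> G q) & finset_of l |- p.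
Proof.
(* Separates a hypothesis discharged by a rule from the rest of a finite list. *)
have sep G' q l : (forall r, List.In r l -> (G' `|` [set q]) r) ->
    exists2 l', (forall r, List.In r l' -> G' r) &
      finset_of l `<=` finset_of l' `|` [set q].
  elim: l => [|r l IH] h; first by exists nil.
  have [|l' Gl' ll'] := IH; first by move=> r' r'l; apply: h; right.
  have [Gr|->] : (G' `|` [set q]) r by apply: h; left.
    exists (r :: l') => [r' [<-//|/Gl'//]|r' [<-|/ll'[]]]; [by left; left| |by right].
    by left; right.
  by exists l' => // r' [<-|/ll'//]; right.
have ax0 q : set0 |- q -> exists2 l, (forall r, List.In r l -> set0 r) & finset_of l |- q.
  by exists nil => //; exact: weaken0.
have ax1 q r : [set q] |- r ->
    exists2 l, (forall r, List.In r l -> [set q] r) & finset_of l |- r.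
  by exists (cons q nil) => [_ [<-|[]]|] //; apply: weaken H => _ ->; left.
have ax2 q q' r : [set q; q'] |- r ->
    exists2 l, (forall r, List.In r l -> [set q; q'] r) & finset_of l |- r.
  exists (cons q (cons q' nil)) => [_ [<-|[<-|[]]]|]; [by left|by right|].
  by apply: weaken H => _ [->|->]; [left|right; left].
elim=> {G p}.
- move=> q; apply: ax1; exact: P1.
- by move=> G D q _ [l Gl lq]; exists l => // r /Gl; left.
- move=> G q r _ [l1 Gl1 lq] _ [l /sep[l2 Gl2 l12] lr].
  exists (l1 ++ l2) => [r' /In_cat[/Gl1|/Gl2]//|].
  apply: (@P3 _ _ _ _ q); [apply: weaken lq|apply: weaken lr] => r' h.
    by apply/In_cat; left.
  by have [|->] := l12 _ h; [left; apply/In_cat; right|right].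
- by move=> q; apply: ax0; exact: C1.
- by move=> q; apply: ax1; exact: C2.
- by move=> q; apply: ax2; exact: C3.
- by move=> q; apply: ax1; exact: D1.
- by move=> q r; apply: ax2; exact: AndI.
- by move=> q r; apply: ax1; exact: AndE1.
- by move=> q r; apply: ax1; exact: AndE2.
- by move=> q r; apply: ax1; exact: OrI1.
- by move=> q r; apply: ax1; exact: OrI2.
- move=> G q r r' _ [l /sep[l1 Gl1 l1q] lr'] _ [l' /sep[l2 Gl2 l2r] lr''].
  exists (Or q r :: l1 ++ l2) => [w [<-|/In_cat[/Gl1|/Gl2]]|]; [by right|by left|by left|].
  apply: (@cases _ _ _ _ q r); first by apply: assumption; left.
    apply: weaken lr' => w /l1q[h|->]; last by right.
    by left; right; apply/In_cat; left.
  apply: weaken lr'' => w /l2r[h|->]; last by right.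
  by left; right; apply/In_cat; right.
- by move=> t; apply: ax1; exact: Eq1.
- by move=> q n xs ts i t' h1 h2 h3; apply: ax2; exact: Eq2.
- by move=> x t q h; apply: ax2; exact: AllE.
- move=> G x q _ [l Gl lq] nx; exists l => //; apply: AllI lq _ => r /Gl; exact: nx.
- by move=> x t q h; apply: ax1; exact: ExI.
- move=> G x y q r _ [l /sep[l1 Gl1 l1q] lr] nG nq nr.
  exists (Ex x q :: l1) => [w [<-|/Gl1]|]; [by right|by left|].
  have : finset_of l1 `|` [set Ex x q] |- r.
    apply: ExE (weaken l1q lr) _ nq nr => w /Gl1; exact: nG.
  by apply: weaken => w [|->]; [right|left].
Qed.

Lemma derive_all G l p : (forall q, List.In q l -> G |- q) -> finset_of l |- p -> G |- p.
Proof.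
move=> Gl lp; have : G `|` finset_of l |- p by apply: weaken lp => q; right.
elim: l Gl {lp} => [|q l IH] Gl lp; first by apply: weaken lp => r [].
apply: IH => [r rl|]; first by apply: Gl; right.
apply: (@P3 _ _ _ _ q); first by apply: weaken (Gl q _) => [r|]; left.
by apply: weaken lp => r [Gr|[<-|rl]]; [left; left|right|left; right].
Qed.

(** By compactness a refutation uses finitely many formulas. Their conjunction is a single formula,
    to which [refutation_double] applies. *)
Lemma consistent_double G (F : formula S -> formula S) :
  (forall p, is_subst (fun x => Var x.*2) p (F p)) ->
  ~ G |- Fls -> ~ [set F p | p in G] |- Fls.
Proof.
move=> sF nG /compactness[l Gl lF]; apply: nG.
have {Gl} [m Gm lm] : exists2 m, (forall q, List.In q m -> G q) &
    finset_of l `<=` finset_of (map F m).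
  elim: l Gl {lF} => [|q l IH] Gl; first by exists nil.
  have [|m Gm lm] := IH; first by move=> r rl; apply: Gl; right.
  have [r Gr rq] : [set F p | p in G] q by apply: Gl; left.
  exists (r :: m) => [w [<-//|/Gm//]|w [<-|/lm]]; [by left|by right].
pose Conj := foldr (@And S) Tru.
have Cl G' k : (forall q, List.In q k -> G' |- q) -> G' |- Conj k.
  elim: k => [|q k IH] h; first exact: derive_Tru.
  by apply: derive_And; [apply: h; left|apply: IH => r rk; apply: h; right].
have lC G' k q : List.In q k -> G' |- Conj k -> G' |- q.
  elim: k => [//|r k IH] [<-|qk] h; first exact: derive_And1 h.
  exact: IH qk (derive_And2 h).
have sC : is_subst (fun x => Var x.*2) (Conj m) (Conj (map F m)).
  by elim: m {Gm lm} => [//|q m IH]; exists (F q), (Conj (map F m)).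
apply: derive1 (refutation_double sC _) (Cl _ _ _) => [|q /Gm]; last exact: assumption.
exact: derive_all (fun q => @lC _ _ q ^~ (P1 _ _)) (weaken lm lF).
Qed.

End Consistency.

(** * Enumeration of all formulas by coding them as trees of naturals *)

Section Countability.
Variable S : signature.
Implicit Types (t u : term S) (p q r phi psi chi : formula S) (x y z : var).

Local Notation leaf n := (GenTree.Leaf n : GenTree.tree nat).

Fixpoint tcode t : GenTree.tree nat :=
  match t with
  | Var x => GenTree.Node 0 [:: leaf x]
  | Cst c => GenTree.Node 1 [:: leaf (pickle c)]
  | App f ts => GenTree.Node 2
      (leaf (pickle f) :: [seq tcode (ts i) | i <- enum 'I_(farity f)])
  end.

Fixpoint fcode phi : GenTree.tree nat :=
  match phi with
  | Fls => GenTree.Node 0 [::]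
  | Tru => GenTree.Node 1 [::]
  | Eq t u => GenTree.Node 2 [:: tcode t; tcode u]
  | Rel R ts => GenTree.Node 3
      (leaf (pickle R) :: [seq tcode (ts i) | i <- enum 'I_(rarity R)])
  | Neg p => GenTree.Node 4 [:: fcode p]
  | And p q => GenTree.Node 5 [:: fcode p; fcode q]
  | Or p q => GenTree.Node 6 [:: fcode p; fcode q]
  | All x p => GenTree.Node 7 [:: leaf x; fcode p]
  | Ex x p => GenTree.Node 8 [:: leaf x; fcode p]
  end.

(** Injectivity is assumed only at the entries of [ts], as this is what induction on terms
    provides. *)
Lemma ffun_code_inj (A : Type) n (F : A -> GenTree.tree nat) (ts us : {ffun 'I_n -> A}) :
  (forall i a, F (ts i) = F a -> ts i = a) ->
  [seq F (ts i) | i <- enum 'I_n] = [seq F (us i) | i <- enum 'I_n] -> ts = us.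
Proof.
move=> h /eq_in_map e; apply/ffunP => i; apply: h.
by apply: e; rewrite mem_enum.
Qed.

Lemma tcode_inj : injective tcode.
Proof.
elim/term_induction => [x|c|f ts IH] [y|d|g us] //=.
- by move=> [->].
- by move=> [] /(pcan_inj pickleK)->.
(* The equality of function symbols is eliminated first, so that both argument tuples have the same
   type. *)
- move=> [] /(pcan_inj pickleK) fg; case: _ / fg us => us /ffun_code_inj -> //.
Qed.

Lemma fcode_inj : injective fcode.
Proof.
elim=> [||t u|R ts|p IH|p IHp q IHq|p IHp q IHq|x p IH|x p IH]
  [||t' u'|R' ts'|p'|p' q'|p' q'|x' p'|x' p'] //=.
- by move=> [/tcode_inj-> /tcode_inj->].
- move=> [] /(pcan_inj pickleK) RR'; case: _ / RR' ts' => ts' /ffun_code_inj -> //.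
  by move=> i u /tcode_inj.
- by move=> [/IH->].
- by move=> [/IHp-> /IHq->].
- by move=> [/IHp-> /IHq->].
- by move=> [-> /IH->].
- by move=> [-> /IH->].
Qed.

Lemma formula_enum : exists e : nat -> formula S, forall p, exists n, e n = p.
Proof.
have /choice[e eP] : forall n, exists p, forall q, pickle (fcode q) = n -> q = p.
  move=> n; have [[p <-]|h] := pselect (exists p, pickle (fcode p) = n).
    by exists p => q /(pcan_inj pickleK)/fcode_inj.
  by exists Fls => q qn; case: h; exists q.
by exists e => p; exists (pickle (fcode p)); exact/esym/eP.
Qed.

End Countability.

(** * Extension of a consistent set to a saturated one *)

Section Henkin.
Variables (S : signature) (delta : isdef S) (rho : renaming delta).
Implicit Types (t u : term S) (p q r phi psi chi : formula S) (x y z : var).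
Implicit Types (s : var -> term S) (G D : set (formula S)).

Local Notation "G |- p" := (provable rho G p) (at level 75, p at level 70).

(** Cofinitely many odd variables are kept in reserve for witnesses, while all even ones may be in
    use. *)
Definition odd_fresh G := exists N, forall p x, G p -> occ x p -> odd x -> x < N.

Definition witnessed G x q :=
  exists c r, is_subst (upd Var x (Var c)) q r /\ G r.

(** A formula inconsistent with [G] is skipped; any other is added, an existential one together with
    an instance at a fresh variable, which is harmless by the rule [ExE]. *)
Lemma henkin_step G p : ~ G |- Fls -> odd_fresh G ->
  exists G', [/\ G `<=` G', ~ G' |- Fls, odd_fresh G',
    G' p \/ G `|` [set p] |- Fls & forall x q, p = Ex x q -> G' p -> witnessed G' x q].
Proof.
move=> Gc [N fG]; have [pF|pc] := pselect (G `|` [set p] |- Fls).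
  exists G; split=> //; [by exists N|by right|move=> x q _ Gp].
  by case: Gc; apply: weaken pF => r [|->].
have [M oM] := occ_bound p.
have fU G' K q : (forall q x, G' q -> occ x q -> odd x -> x < K) ->
    (forall x, occ x q -> odd x -> x < K) ->
    forall r x, (G' `|` [set q]) r -> occ x r -> odd x -> x < K.
  by move=> h1 h2 r x [/h1|->]; [apply|exact: h2].
have fp : forall r x, (G `|` [set p]) r -> occ x r -> odd x -> x < maxn N M.
  apply: fU => [q x Gq ox oddx|x /oM xM _]; last by rewrite leq_max xM orbT.
  by rewrite leq_max (fG q).
have [[x [q pE]]|np] := pselect (exists x q, p = Ex x q); last first.
  exists (G `|` [set p]); split=> //.
  - by exists (maxn N M).
  - by left; right.
  - by move=> x q pE; case: np; exists x, q.
(* An odd number not below either bound, so [c] occurs neither in [G] nor in [p]. *)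
pose c := (maxn N M).*2.+1.
have oc : odd c by rewrite /= odd_double.
have Nc : maxn N M <= c by rewrite /c -addnn leqW // leq_addr.
have nc r : (G `|` [set p]) r -> ~~ occ c r.
  by move=> Gr; apply/negP => ocr; have := fp _ _ Gr ocr oc; rewrite ltnNge Nc.
have ncp : ~~ occ c (Ex x q) by rewrite -pE; apply: nc; right.
have ncq : ~~ occ c q by move: ncp; rewrite /= negb_or => /andP[].
pose r := subst1 x (Var c) q; exists (G `|` [set p] `|` [set r]); split.
- by move=> w Gw; left; left.
- move=> rF; apply: pc.
  have : G `|` [set p] `|` [set Ex x q] |- Fls by apply: (ExE rF).
  by apply: weaken => w [//|->]; right.
- have [K oK] := occ_bound r; exists (maxn (maxn N M) K); apply: fU => [w z Gw ow oz|z /oK zK _].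
    by rewrite leq_max (fp w).
  by rewrite leq_max zK orbT.
- by left; left; right.
- move=> x' q'; rewrite pE => -[<- <-] _; exists c, r; split; last by right.
  exact/is_subst_subst1/free_for_fresh.
Qed.

(** All formulas are treated in turn along an enumeration; the union of the stages is consistent
    because a refutation already lives in one stage. *)
Lemma henkin G : ~ G |- Fls -> odd_fresh G ->
  exists H, [/\ G `<=` H, ~ H |- Fls, forall p, H |- p -> H p,
    forall p q, H (Or p q) -> H p \/ H q & forall x q, H (Ex x q) -> witnessed H x q].
Proof.
move=> Gc fG; have [e eP] := formula_enum S.
pose T := {G | ~ G |- Fls /\ odd_fresh G}.
have /choice[next nextP] : forall a : nat * T, exists b : T, [/\ sval a.2 `<=` sval b,
    sval b (e a.1) \/ sval a.2 `|` [set e a.1] |- Fls &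
    forall x q, e a.1 = Ex x q -> sval b (e a.1) -> witnessed (sval b) x q].
  move=> [n [D [Dc fD]]]; have [D' [h1 h2 h3 h4 h5]] := henkin_step (e n) Dc fD.
  by exists (exist _ D' (Logic.conj h2 h3)).
pose st := fix st n : T := if n is k.+1 then next (k, st k) else exist _ G (Logic.conj Gc fG).
have mono m n : m <= n -> sval (st m) `<=` sval (st n).
  elim: n => [|n IH]; first by rewrite leqn0 => /eqP->.
  rewrite leq_eqVlt => /orP[/eqP->//|/IH h] p /h; have [+ _ _] := nextP (n, st n); exact.
pose H p := exists n, sval (st n) p.
have Hst n : sval (st n) `<=` H by move=> p; exists n.
have Hc : ~ H |- Fls.
  move=> /compactness[l Hl lF].
  have [n hn] : exists n, forall q, List.In q l -> sval (st n) q.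
    elim: l Hl {lF} => [|q l IH] Hl; first by exists 0.
    have [|n hn] := IH; first by move=> r rl; apply: Hl; right.
    have [m hm] : H q by apply: Hl; left.
    exists (maxn m n) => r [<-|/hn]; first by apply: mono hm; rewrite leq_maxl.
    by apply: mono; rewrite leq_maxr.
  by have [] := svalP (st n); case; exact: weaken lF.
(* Maximality, from which both deductive closure and primeness follow. *)
have dich p : H p \/ H `|` [set p] |- Fls.
  have [n <-] := eP p; have [_ [h|h] _] := nextP (n, st n).
    by left; exists n.+1.
  by right; apply: weaken h => q [/Hst|]; [left|right].
exists H; split=> //; first exact: (Hst 0).
- by move=> p Hp; case: (dich p) => // pF; case: Hc; exact: P3 Hp pF.
- move=> p q Hpq; case: (dich p) => [|pF]; first by left.
  case: (dich q) => [|qF]; first by right.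
  by case: Hc; apply: cases (assumption _ Hpq) pF qF.
(* An existential in [H] cannot have been skipped at its own stage, for [H] would then be
   inconsistent; hence its witness was added there. *)
- move=> x q Hq; have [n En] := eP (Ex x q); have [_ h w] := nextP (n, st n).
  have [h'|h'] : sval (st n.+1) (Ex x q) \/ sval (st n) `|` [set Ex x q] |- Fls.
  + by rewrite -En; exact: h.
  + have [c [r [sr Hr]]] : witnessed (sval (st n.+1)) x q by apply: w; rewrite /= En.
    by exists c, r; split=> //; exists n.+1.
  + case: Hc; apply: P3 (assumption _ Hq) _.
    by apply: weaken h' => r [/Hst|]; [left|right].
Qed.

End Henkin.

(** * Saturated sets obey the truth tables of strong Kleene logic *)

Record saturated (S : signature) (delta : isdef S) (rho : renaming delta)
    (H : set (formula S)) : Prop := {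
  saturated_consistent : ~ provable rho H Fls;
  saturated_closed : forall p, provable rho H p -> H p;
  saturated_prime : forall p q, H (Or p q) -> H p \/ H q;
  saturated_witness : forall x q, H (Ex x q) -> witnessed H x q }.

Section Saturated.
Variables (S : signature) (delta : isdef S) (rho : renaming delta).
Variables (H : set (formula S)) (Hs : saturated rho H).
Implicit Types (t u : term S) (p q r phi psi chi : formula S) (x y z c : var).
Implicit Types s : var -> term S.

Local Notation "G |- p" := (provable rho G p) (at level 75, p at level 70).
Local Notation Def := (Def rho).
Local Notation tDef := (tDef rho).

Let cl := saturated_closed Hs.
Let ax p : H p -> H |- p := @assumption _ _ rho H p.

Lemma saturatedP p : H p <-> H |- p.
Proof. by split=> [/ax|/cl]. Qed.

Lemma saturated_contra p : H p -> ~ H (Neg p).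
Proof.
by move=> /ax Hp /ax Hn; apply: (saturated_consistent Hs); exact: contradiction Hp Hn.
Qed.

Lemma saturated_cases p : [\/ H p, H (Neg p) | H (Neg (Def p))].
Proof.
have /cl/(saturated_prime Hs)[/(saturated_prime Hs)[]|] := weaken0 H (C1 rho p).
- exact: Or31.
- exact: Or32.
- exact: Or33.
Qed.

Lemma saturated_Def p : H p -> H (Def p).
Proof. by move=> /ax/derive_Def/cl. Qed.

Lemma saturated_DefNeg p : H (Neg p) -> H (Def p).
Proof. exact: (@saturated_Def (Neg p)). Qed.

Lemma saturated_em p : H (Def p) -> H p \/ H (Neg p).
Proof.
by move=> Hd; case: (saturated_cases p) => [h|h|/(saturated_contra Hd)//]; [left|right].
Qed.

Lemma saturated_And p q : H (And p q) <-> H p /\ H q.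
Proof.
split=> [/ax h|[/ax hp /ax hq]]; last exact/cl/derive_And.
by split; apply: cl; [exact: derive_And1 h|exact: derive_And2 h].
Qed.

Lemma saturated_Or p q : H (Or p q) <-> H p \/ H q.
Proof.
split=> [/(saturated_prime Hs)//|[/ax h|/ax h]]; apply: cl.
  exact: derive_Or1.
exact: derive_Or2.
Qed.

(** [Def] ignores negations, so either side yields [Def p] by D1, and excluded middle decides. *)
Lemma saturated_NegNeg p : H (Neg (Neg p)) <-> H p.
Proof.
split=> h.
  by case: (@saturated_em p (saturated_DefNeg h)) => // /saturated_contra.
by case: (@saturated_em (Neg p) (saturated_Def h)) => // /(saturated_contra h).
Qed.

(** The disjuncts of [Def (And p q)] list the ways a conjunction gets a classical value; D1 reads
    them off, and conversely a false conjunct supplies one of them. *)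
Lemma saturated_NegAnd p q : H (Neg (And p q)) <-> H (Neg p) \/ H (Neg q).
Proof.
split=> [h|h].
  have /= /saturated_Or[/saturated_Or[]|] := saturated_DefNeg h.
  - move=> /saturated_And[/saturated_em[hp|]]; last by left.
    move=> /saturated_em[hq|]; last by right.
    by have /saturated_contra : H (And p q) by apply/saturated_And.
  - by move=> /saturated_And[]; left.
  - by move=> /saturated_And[]; right.
have /saturated_em[/saturated_And[hp hq]|//] : H (Def (And p q)).
  case: h => h; apply/saturated_Or; [left; apply/saturated_Or; right|right];
  by apply/saturated_And; split=> //; exact: saturated_DefNeg.
by case: h => /(saturated_contra _)[].
Qed.

Lemma saturated_NegOr p q : H (Neg (Or p q)) <-> H (Neg p) /\ H (Neg q).
Proof.
split=> [h|[hp hq]].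
  have np : ~ H p by move=> hp; apply: saturated_contra h; apply/saturated_Or; left.
  have nq : ~ H q by move=> hq; apply: saturated_contra h; apply/saturated_Or; right.
  have /= /saturated_Or[/saturated_Or[]|] := saturated_DefNeg h.
  - by move=> /saturated_And[/saturated_em[//|?] /saturated_em[//|?]].
  - by move=> /saturated_And[].
  - by move=> /saturated_And[].
have /saturated_em[/saturated_Or[]|//] : H (Def (Or p q)).
- apply/saturated_Or; left; apply/saturated_Or; left; apply/saturated_And.
  by split; exact: saturated_DefNeg.
- by move=> /saturated_contra.
- by move=> /saturated_contra.
Qed.

Lemma saturated_Def_subst x c p q r : is_subst (upd Var x (Var c)) p q ->
  is_subst (upd Var x (Var c)) (Def p) r -> H (Def q) <-> H r.
Proof.
move=> spq sr; rewrite !saturatedP; apply: derive_Def_is_subst spq sr.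
exact: total_subst_upd.
Qed.

Local Notation inst x c := (is_subst (upd Var x (Var c))).

Lemma saturated_Neg_All_ex x p : H (Neg (All x p)) ->
  exists c r, inst x c p r /\ H (Neg r).
Proof.
move=> /ax/derive_Neg_All/cl/(saturated_witness Hs)[c [_ [[r -> sr] Hr]]].
by exists c, r.
Qed.

(** Both definedness formulas have [All x (Def p)] as a disjunct, so negating either one refutes it
    and produces a witness. *)
Lemma saturated_Def_All x p : H (Neg (Def (All x p))) \/ H (Neg (Def (Ex x p))) ->
  exists c r, inst x c p r /\ ~ H (Def r).
Proof.
have {}E : H (Neg (Def (All x p))) \/ H (Neg (Def (Ex x p))) -> H (Neg (All x (Def p))).
  by case=> /saturated_NegOr[].
move=> /E /saturated_Neg_All_ex[c [d [sd Hd]]].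
have [r sr] := is_subst_exists (upd Var x (Var c)) p.
exists c, r; split=> // /(saturated_Def_subst sr sd) Hd'; exact: saturated_contra Hd' Hd.
Qed.

(** For the converse, if [All x p] were false or undefined, a witness would give a false or
    undefined instance, whereas all instances are in [H]. *)
Lemma saturated_All x p : H (All x p) <-> forall c r, inst x c p r -> H r.
Proof.
split=> [/ax h c r sr|h].
  by apply: cl; apply: derive_AllE_subst (sr) _ h; exact: derive_Tru.
have [//|/saturated_Neg_All_ex|nd] := saturated_cases (All x p).
  by move=> [c [r [/h/saturated_contra]]].
have [|c [r [/h/saturated_Def]]//] := @saturated_Def_All x p.
by left.
Qed.

Lemma saturated_Ex x p : H (Ex x p) <-> exists c r, inst x c p r /\ H r.
Proof.
split=> [/(saturated_witness Hs)//|[c [r [sr /ax Hr]]]].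
by apply: cl; exact: derive_ExI_subst sr Hr.
Qed.

Lemma saturated_Def_AllEx x p : H (All x (Def p)) -> forall c r, inst x c p r -> H (Def r).
Proof.
move=> /saturated_All h c r sr.
have [d sd] := is_subst_exists (upd Var x (Var c)) (Def p).
by apply/(saturated_Def_subst sr sd); exact: h sd.
Qed.

Lemma saturated_NegAll x p : H (Neg (All x p)) <-> exists c r, inst x c p r /\ H (Neg r).
Proof.
split=> [/saturated_Neg_All_ex//|[c [r [sr Hr]]]].
suff /saturated_em[/saturated_All/(_ c r sr)/saturated_contra[]//|//] : H (Def (All x p)).
apply/saturated_Or; right; apply/saturated_Ex.
have [d sd] := is_subst_exists (upd Var x (Var c)) (Def p).
exists c, (And d (Neg r)); split; first by exists d, (Neg r); split=> //; exists r.
apply/saturated_And; split=> //; apply/(saturated_Def_subst sr sd).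
exact: saturated_DefNeg.
Qed.

Lemma saturated_NegEx x p : H (Neg (Ex x p)) <-> forall c r, inst x c p r -> H (Neg r).
Proof.
split=> [h c r sr|h].
  have nr r' : inst x c p r' -> ~ H r'.
    by move=> sr' Hr'; apply: saturated_contra h; apply/saturated_Ex; exists c, r'.
  have /= /saturated_Or[/saturated_Def_AllEx/(_ c r sr)|] := saturated_DefNeg h.
    by move=> /saturated_em[/(nr r sr)|].
  move=> /saturated_Ex[c' [_ [[d [q [-> sd sq]] /saturated_And[_ Hq]]]]].
  by case: (saturated_contra _ h); apply/saturated_Ex; exists c', q.
have [/saturated_Ex[c [r [/h]]]|//|nd] := saturated_cases (Ex x p).
  by move=> hr /saturated_contra.
have [|c [r [/h/saturated_DefNeg]]//] := @saturated_Def_All x p.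
by right.
Qed.

Lemma substn_ordE n (ts : 'I_n -> term S) phi :
  substn (fun i : 'I_n => nat_of_ord i) ts phi = subst (args ts) phi.
Proof.
rewrite /substn; congr subst; apply/funext => x; rewrite /args.
case: pickP => [i /eqP<-|h]; first by rewrite valK.
by case: insubP => // i _ ix; have := h i; rewrite /= ix eqxx.
Qed.

(** The rule [Eq2] replaces one entry at a time; the tuple [hyb k] has its first [k] entries
    replaced. *)
Lemma saturated_congr n (ts us : 'I_n -> term S) phi :
  (forall t x, free_for t x phi) -> (forall i, H (Eq (ts i) (us i))) ->
  H (subst (args ts) phi) -> H (subst (args us) phi).
Proof.
move=> ff e; rewrite -!substn_ordE => h.
pose hyb k (i : 'I_n) := if i < k then us i else ts i.
suff hk k : k <= n -> H (substn (fun i : 'I_n => nat_of_ord i) (hyb k) phi).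
  have := hk n (leqnn n); congr (H (substn _ _ _)); apply/funext => i.
  by rewrite /hyb ltn_ord.
elim: k => [_|k IH kn].
  have -> // : hyb 0 = ts by apply/funext => i; rewrite /hyb.
pose i := Ordinal kn.
have -> : hyb k.+1 = fun j => if j == i then us i else hyb k j.
  apply/funext => j; rewrite /hyb ltnS leq_eqVlt.
  by have -> : (nat_of_ord j == k) = (j == i) by []; case: eqP => [->|].
apply: cl; apply: derive2 (Eq2 rho (phi := phi) (xs := fun i : 'I_n => nat_of_ord i)
  (ts := hyb k) (i := i) (t' := us i) _ _ _) _ _ => //.
- exact: ord_inj.
- by apply: ax; rewrite {1}/hyb ltnn.
- exact/ax/IH/ltnW.
Qed.

Lemma saturated_tDef t : H (tDef t) -> H (Eq t t).
Proof. by move=> /ax h; apply: cl; exact: derive1 (Eq1 rho t) h. Qed.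

Lemma saturated_Eq_tDef t u : H (Eq t u) -> H (tDef t) /\ H (tDef u).
Proof. by move=> /saturated_Def /= /saturated_And. Qed.

Lemma saturated_Eq2 a a' b b' : H (Eq a a') -> H (Eq b b') -> H (Eq a b) -> H (Eq a' b').
Proof.
move=> ha hb hab.
pose pr t u (i : 'I_2) := if i == ord0 then t else u.
have E t u : subst (args (pr t u)) (Eq (Var 0) (Var 1)) = Eq t u.
  by rewrite /= (argsE _ ord0) (argsE _ (Ordinal (isT : 1 < 2))).
rewrite -E; apply: (@saturated_congr _ (pr a b)) => //; last by rewrite E.
by move=> i; rewrite /pr; case: eqP.
Qed.

Lemma saturated_Eq_sym a b : H (Eq a b) -> H (Eq b a).
Proof.
move=> h; have [/saturated_tDef ha _] := saturated_Eq_tDef h.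
exact: (saturated_Eq2 h ha ha).
Qed.

Lemma saturated_Eq_trans a b d : H (Eq a b) -> H (Eq b d) -> H (Eq a d).
Proof.
move=> hab hbc; have [/saturated_tDef ha _] := saturated_Eq_tDef hab.
exact: (saturated_Eq2 ha hbc hab).
Qed.

Lemma saturated_App_congr f (ts us : {ffun 'I_(farity f) -> term S}) t :
  (forall i, H (Eq (ts i) (us i))) -> H (Eq t (App f ts)) -> H (Eq t (App f us)).
Proof.
move=> e h; have [/saturated_tDef ht _] := saturated_Eq_tDef h; set n := farity f.
(* The tuple is lengthened by [t] at index [n], to instantiate the template stating that [Var n]
   equals [f] of the variables below [n]. *)
pose ext (ws : {ffun 'I_n -> term S}) (i : 'I_n.+1) := oapp ws t (insub (nat_of_ord i)).
have E ws : subst (args (ext ws)) (Eq (Var n) (App f [ffun i : 'I_n => Var i])) =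
    Eq t (App f ws).
  rewrite /= (argsE _ ord_max) /ext insubF ?ltnn //=; congr (Eq _ (App f _)).
  apply/ffunP => i; rewrite !ffunE /=.
  by rewrite (argsE _ (widen_ord (leqnSn n) i)) /= valK.
rewrite -E; apply: (@saturated_congr _ (ext ts)) => //; last by rewrite E.
by move=> i; rewrite /ext; case: insubP => [j _ _|_] //=.
Qed.

Lemma saturated_Rel_congr (R : rel_sym S) (ts us : {ffun 'I_(rarity R) -> term S}) :
  (forall i, H (Eq (ts i) (us i))) -> H (Rel R ts) -> H (Rel R us).
Proof.
move=> e h.
have E (ws : {ffun 'I_(rarity R) -> term S}) :
    subst (args ws) (Rel R [ffun i : 'I_(rarity R) => Var i]) = Rel R ws.
  by rewrite /=; congr Rel; apply/ffunP => i; rewrite !ffunE /= argsE.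
by rewrite -E; apply: (@saturated_congr _ ts) => //; rewrite E.
Qed.

(** Reflexivity of a defined [t] is an instance of the existential claim that some [N] fresh for [t]
    equals [t]; its witness is the required variable. *)
Lemma saturated_tDef_var t : H (tDef t) <-> exists c, H (Eq (Var c) t).
Proof.
split=> [/saturated_tDef h|[c /saturated_Eq_tDef[]//]].
have [N oN] := tocc_bound t.
have nN : ~~ tocc N t by apply/negP => /oN; rewrite ltnn.
have : H (Ex N (Eq (Var N) t)).
  apply: cl; apply: (derive_ExI_subst _ (ax h)).
  by rewrite /= updE tsubst_fresh // tsubst_Var.
move=> /(saturated_witness Hs)[c [_ [-> Hc]]]; exists c.
by move: Hc; rewrite /= updE tsubst_fresh // tsubst_Var.
Qed.

End Saturated.

(** * When connectives and quantifiers take the values [vT] and [vF] *)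

Section TruthValues.

Lemma vneg_T a : vneg a = vT <-> a = vF. Proof. by case: a. Qed.
Lemma vneg_F a : vneg a = vF <-> a = vT. Proof. by case: a. Qed.

Lemma vmin_T a b : vmin a b = vT <-> a = vT /\ b = vT.
Proof. by case: a; case: b; split=> // -[]. Qed.

Lemma vmin_F a b : vmin a b = vF <-> a = vF \/ b = vF.
Proof. by case: a; case: b; split=> //; [left|left|left|right|case|case|right|case|case]. Qed.

Lemma vmax_T a b : vmax a b = vT <-> a = vT \/ b = vT.
Proof. by case: a; case: b; split=> //; tauto || (case=> //). Qed.

Lemma vmax_F a b : vmax a b = vF <-> a = vF /\ b = vF.
Proof. by case: a; case: b; split=> // -[]. Qed.

Variables (A : Type) (h : A -> Defs.tval).

Lemma vinf_T : vinf h = vT <-> forall a, h a = vT.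
Proof.
rewrite /vinf; case: asboolP => [[a ha]|nF]; first by split=> // /(_ a); rewrite ha.
case: asboolP => [[a ha]|nU]; first by split=> // /(_ a); rewrite ha.
split=> // _ a; case E: (h a) => //; first by case: nF; exists a.
by case: nU; exists a.
Qed.

Lemma vinf_F : vinf h = vF <-> exists a, h a = vF.
Proof. by rewrite /vinf; case: asboolP => // nF; case: asboolP. Qed.

Lemma vsup_T : vsup h = vT <-> exists a, h a = vT.
Proof. by rewrite /vsup; case: asboolP => // nT; case: asboolP. Qed.

Lemma vsup_F : vsup h = vF <-> forall a, h a = vF.
Proof.
rewrite /vsup; case: asboolP => [[a ha]|nT]; first by split=> // /(_ a); rewrite ha.
case: asboolP => [[a ha]|nU]; first by split=> // /(_ a); rewrite ha.
split=> // _ a; case E: (h a) => //; first by case: nU; exists a.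
by case: nT; exists a.
Qed.

Lemma vclassical_T P : vclassical P = vT <-> P.
Proof. by rewrite /vclassical; case: asboolP. Qed.

Lemma vclassical_F P : vclassical P = vF <-> ~ P.
Proof. by rewrite /vclassical; case: asboolP. Qed.

End TruthValues.

Lemma all_definedP (S : signature) (M : structure S) n (d : dom M) (vs : 'I_n -> option (dom M)) :
  (exists2 ds : {ffun 'I_n -> dom M}, all_defined d vs = Some ds &
     forall i, vs i = Some (ds i)) \/
  (all_defined d vs = None /\ exists i, vs i = None).
Proof.
rewrite /all_defined; case: forallP => [h|h].
  left; eexists; first reflexivity; move=> i; rewrite ffunE.
  by case: (vs i) (h i).
right; split=> //; apply: contrapT => nN; apply: h => i.
by case E: (vs i) => //; case: nN; exists i.
Qed.

(** * The model of variables modulo provable equality *)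

Section TermModel.
Variables (S : signature) (delta : isdef S) (rho : renaming delta).
Variables (H : set (formula S)) (Hs : saturated rho H).
Implicit Types (t u : term S) (p q r phi psi chi : formula S) (x y z c : var).
Implicit Types (s : var -> term S) (sg : var -> var).

Local Notation Def := (Def rho).
Local Notation tDef := (tDef rho).

Lemma Var_Eq_refl x : H (Eq (Var x) (Var x)).
Proof.
apply: (saturated_tDef Hs); apply: (saturated_closed Hs); exact: derive_Tru.
Qed.

(** Choosing the least provably equal variable realizes the quotient as a subset of the
    variables. *)
Definition rep x : var :=
  ex_minn (ex_intro (fun y => `[< H (Eq (Var x) (Var y)) >]) x (asboolT (Var_Eq_refl x))).

Lemma rep_Eq x : H (Eq (Var x) (Var (rep x))).
Proof. by rewrite /rep; case: ex_minnP => y /asboolP. Qed.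

Lemma rep_eqP x y : rep x = rep y <-> H (Eq (Var x) (Var y)).
Proof.
split=> [e|h].
  apply: (saturated_Eq_trans Hs (rep_Eq x)); rewrite e.
  exact: (saturated_Eq_sym Hs (rep_Eq y)).
have le a b : H (Eq (Var a) (Var b)) -> rep a <= rep b.
  move=> ab; rewrite {1}/rep; case: ex_minnP => c _; apply; apply/asboolP.
  exact: (saturated_Eq_trans Hs ab (rep_Eq b)).
by apply/eqP; rewrite eqn_leq !le //; exact: (saturated_Eq_sym Hs).
Qed.

Definition tdom := {x : var | rep x == x}.

Lemma rep_idem x : rep (rep x) == rep x.
Proof. by apply/eqP/rep_eqP/(saturated_Eq_sym Hs)/rep_Eq. Qed.

Definition cls x : tdom := exist _ (rep x) (rep_idem x).

Lemma cls_val (d : tdom) : cls (val d) = d.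
Proof. by apply: val_inj; exact/eqP/(valP d). Qed.

Lemma cls_eqP x y : cls x = cls y <-> H (Eq (Var x) (Var y)).
Proof. by rewrite -rep_eqP; split=> [[]|e] //; exact: val_inj. Qed.

Definition class_of_term t : option tdom :=
  if pselect (exists c, H (Eq (Var c) t)) is left h then Some (cls (sval (cid h))) else None.

Lemma class_of_termP t c : class_of_term t = Some (cls c) <-> H (Eq (Var c) t).
Proof.
rewrite /class_of_term; case: pselect => [h|nh]; last by split=> // h; case: nh; exists c.
case: cid => c' /= h'; split=> [[/rep_eqP e]|h''].
  by apply: (saturated_Eq_trans Hs (saturated_Eq_sym Hs e)).
congr Some; apply/cls_eqP; apply: (saturated_Eq_trans Hs h').
exact: (saturated_Eq_sym Hs).
Qed.

Lemma Cst_class (k : const S) : exists d, class_of_term (Cst k) = Some d.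
Proof.
have /(saturated_tDef_var Hs)[x /class_of_termP->] : H (tDef (Cst k)).
  apply: (saturated_closed Hs); exact: derive_Tru.
by exists (cls x).
Qed.

Definition var_of n (ds : {ffun 'I_n -> tdom}) : {ffun 'I_n -> term S} :=
  [ffun i => Var (val (ds i))].

Definition term_model : structure S := @Structure S tdom (inhabits (cls 0))
  (fun k => sval (cid (Cst_class k)))
  (fun f ds => class_of_term (App f (var_of ds)))
  (fun R => [set ds | H (Rel R (var_of ds))]).

Definition cls_assignment sg : assignment term_model := fun x => cls (sg x).

Local Notation sval_ sg := (fun x => Var (sg x) : term S).

(** If all arguments have values, congruence replaces them by their representatives. If one has
    none, D1 applied to an equation for the compound term would make that argument defined, so the
    compound has no class either. *)
Lemma teval_term_model sg t :
  teval (cls_assignment sg) t = class_of_term (tsubst (sval_ sg) t).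
Proof.
have ext (o o' : option tdom) : (forall c, o = Some (cls c) <-> o' = Some (cls c)) -> o = o'.
  case: o o' => [d|] [d'|] // h.
  - by have := h (val d); rewrite cls_val => -[/(_ erefl)->].
  - by have := h (val d); rewrite cls_val => -[/(_ erefl)].
  - by have := h (val d'); rewrite cls_val => -[_ /(_ erefl)].
elim/term_induction: t => [x|k|f ts IH].
- by apply/esym/class_of_termP; exact: Var_Eq_refl.
- by rewrite /=; case: cid => d /= ->.
rewrite /=; apply: ext => c; rewrite class_of_termP.
have [[ds -> e] /=|[-> [i ei]]] := all_definedP (cls_assignment sg 0)
    (fun i => teval (cls_assignment sg) (ts i)).
  have E i : H (Eq (var_of ds i) ([ffun i => tsubst (sval_ sg) (ts i)] i)).
    by rewrite !ffunE; apply/class_of_termP; rewrite cls_val -IH e.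
  rewrite class_of_termP; split; apply: (saturated_App_congr Hs) => // i.
  exact: (saturated_Eq_sym Hs).
split=> // /(saturated_Eq_tDef Hs)[_] /(saturatedP Hs)/derive_tDef_App[/(_ i) + _].
rewrite ffunE => /(saturatedP Hs)/(saturated_tDef_var Hs)[d /class_of_termP].
by rewrite -IH ei.
Qed.

Lemma teval_tDef sg t :
  (exists d, teval (cls_assignment sg) t = Some d) <-> H (tDef (tsubst (sval_ sg) t)).
Proof.
rewrite teval_term_model (saturated_tDef_var Hs); split=> [[d]|[c /class_of_termP->]].
  by rewrite -{1}(cls_val d) => /class_of_termP; exists (val d).
by exists (cls c).
Qed.

Lemma class_of_term_Eq t u a b : class_of_term t = Some a -> class_of_term u = Some b ->
  a = b <-> H (Eq t u).
Proof.
rewrite -(cls_val a) -(cls_val b) => /class_of_termP ta /class_of_termP ub.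
rewrite cls_eqP; split=> h.
  apply: (saturated_Eq_trans Hs (saturated_Eq_sym Hs ta)).
  exact: (saturated_Eq_trans Hs h ub).
apply: (saturated_Eq_trans Hs ta); apply: (saturated_Eq_trans Hs h).
exact: (saturated_Eq_sym Hs).
Qed.

Lemma saturated_classical p P : H (Def p) -> (P <-> H p) ->
  (vclassical P = vT <-> H p) /\ (vclassical P = vF <-> H (Neg p)).
Proof.
move=> Hd Pp; rewrite vclassical_T vclassical_F; split=> //; rewrite Pp.
split=> [np|/[swap]]; last exact: (saturated_contra Hs).
by case: (saturated_em Hs Hd).
Qed.

Lemma saturated_undefined p : ~ H (Def p) -> (vU = vT <-> H p) /\ (vU = vF <-> H (Neg p)).
Proof.
move=> nd; split; split=> // h; case: nd.
  exact: saturated_Def h.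
exact: saturated_DefNeg h.
Qed.

(** Quantifying over all substitution results [psi] lets the induction choose bound variables
    freely; the value [vU] is what remains when neither equivalence applies. *)
Lemma truth phi sg psi : is_subst (sval_ sg) phi psi ->
  (eval (cls_assignment sg) phi = vT <-> H psi) /\
  (eval (cls_assignment sg) phi = vF <-> H (Neg psi)).
Proof.
have updc sg' x c : upd (cls_assignment sg') x (cls c) = cls_assignment (upd sg' x c).
  by apply/funext => y; rewrite /cls_assignment /upd; case: eqP.
(* Instantiating the renamed body [q] at [c] composes with the renaming into substitution by the
   updated [sg'] in [p]. *)
have inst sg' x y c p q r : is_subst (upd (sval_ sg') x (Var y)) p q ->
    (forall w, (w != x) && free w p -> ~~ tocc y (Var (sg' w) : term S)) ->
    is_subst (upd Var y (Var c)) q r -> is_subst (sval_ (upd sg' x c)) p r.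
  move=> sp fr sr; apply: is_subst_comp (sp) sr => w fw.
  rewrite -(@upd_comp _ p (sval_ sg') Var (sval_ sg')) //.
  by rewrite /upd; case: eqP.
elim: phi sg psi => /= [||t u|R ts|p IH|p IHp q IHq|p IHp q IHq|x p IH|x p IH] sg psi.
- move=> ->.
  have nF : ~ H Fls by move=> /(saturatedP Hs); exact: (saturated_consistent Hs).
  split; split=> // _.
  (* [Def Fls] is [Tru], so excluded middle forces [Neg Fls] into [H]. *)
  by case: (@saturated_em _ _ _ _ Hs Fls) => //; apply/(saturatedP Hs); exact: derive_Tru.
- move=> ->; have HT : H Tru by apply/(saturatedP Hs); exact: derive_Tru.
  by split; split=> // /(saturated_contra Hs HT).
- move=> ->; have := teval_tDef sg t; have := teval_tDef sg u.
  rewrite !teval_term_model.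
  case E: class_of_term => [a|] hu; case E': class_of_term => [b|] ht.
  + apply: saturated_classical; last exact: class_of_term_Eq E' E.
    by apply/(saturated_And Hs); split; [apply/ht; exists b|apply/hu; exists a].
  + by apply: saturated_undefined => /(saturated_And Hs)[/ht[]].
  + by apply: saturated_undefined => /(saturated_And Hs)[_ /hu[]].
  + by apply: saturated_undefined => /(saturated_And Hs)[/ht[]].
- move=> ->; set us := [ffun i => _].
  have D : H (Def (Rel R us)) <-> forall i, exists d, teval (cls_assignment sg) (ts i) = Some d.
    rewrite (saturatedP Hs) derive_Def_Rel; split=> h i; have := h i.
      by rewrite -(saturatedP Hs) ffunE => /teval_tDef.
    by rewrite -(saturatedP Hs) ffunE => /teval_tDef.
  have [[ds -> e]|[-> [i ei]]] := all_definedP (cls_assignment sg 0)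
    (fun i => teval (cls_assignment sg) (ts i)).
    have E i : H (Eq (var_of ds i) (us i)).
      by rewrite !ffunE; apply/class_of_termP; rewrite cls_val -teval_term_model.
    apply: saturated_classical; first by apply/D => i; exists (ds i).
    split; apply: (saturated_Rel_congr Hs) => // i; exact: (saturated_Eq_sym Hs).
  by apply: saturated_undefined => /D/(_ i)[d]; rewrite ei.
- case=> p' -> /IH[hT hF]; rewrite vneg_T vneg_F hT hF.
  by split=> //; rewrite (saturated_NegNeg Hs).
- case=> p' [q' [-> /IHp[pT pF] /IHq[qT qF]]].
  by rewrite vmin_T vmin_F (saturated_And Hs) (saturated_NegAnd Hs) pT pF qT qF.
- case=> p' [q' [-> /IHp[pT pF] /IHq[qT qF]]].
  by rewrite vmax_T vmax_F (saturated_Or Hs) (saturated_NegOr Hs) pT pF qT qF.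
- case=> y [q [-> fr sp]].
  rewrite vinf_T vinf_F (saturated_All Hs) (saturated_NegAll Hs).
  split; split.
  + move=> h c r sr; apply/(proj1 (IH _ _ (inst _ _ _ _ _ _ _ sp fr sr))); rewrite -updc; exact: h.
  + move=> h d; have [r sr] := is_subst_exists (upd Var y (Var (val d))) q.
    by rewrite -(cls_val d) updc; apply/(proj1 (IH _ _ (inst _ _ _ _ _ _ _ sp fr sr))); exact: h sr.
  + move=> [d hd]; have [r sr] := is_subst_exists (upd Var y (Var (val d))) q.
    exists (val d), r; split=> //; apply/(proj2 (IH _ _ (inst _ _ _ _ _ _ _ sp fr sr))).
    by rewrite -updc cls_val.
  + move=> [c [r [sr Hr]]].
    by exists (cls c); rewrite updc; apply/(proj2 (IH _ _ (inst _ _ _ _ _ _ _ sp fr sr))).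
- case=> y [q [-> fr sp]].
  rewrite vsup_T vsup_F (saturated_Ex Hs) (saturated_NegEx Hs).
  split; split.
  + move=> [d hd]; have [r sr] := is_subst_exists (upd Var y (Var (val d))) q.
    exists (val d), r; split=> //; apply/(proj1 (IH _ _ (inst _ _ _ _ _ _ _ sp fr sr))).
    by rewrite -updc cls_val.
  + move=> [c [r [sr Hr]]].
    by exists (cls c); rewrite updc; apply/(proj1 (IH _ _ (inst _ _ _ _ _ _ _ sp fr sr))).
  + move=> h c r sr; apply/(proj2 (IH _ _ (inst _ _ _ _ _ _ _ sp fr sr))); rewrite -updc; exact: h.
  + move=> h d; have [r sr] := is_subst_exists (upd Var y (Var (val d))) q.
    by rewrite -(cls_val d) updc; apply/(proj2 (IH _ _ (inst _ _ _ _ _ _ _ sp fr sr))); exact: h sr.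
Qed.

(** A function has a value at given representatives iff [H] contains [tDef] of the compound term.
    Variables being defined, this reduces to the isdef conjunct, whose membership in [H] is the
    truth of [delta f]. *)
Lemma term_model_isdef : sat_isdef term_model delta.
Proof.
move=> f ds nu nuE; pose sg x := val (nu x).
have nuS : nu = cls_assignment sg by apply/funext => x; rewrite /cls_assignment cls_val.
have sd : is_subst (sval_ sg) (delta f) (delta_at rho (var_of ds)).
  by apply: delta_at_is_subst => i; rewrite ffunE /sg nuE.
have [hT _] := truth sd; rewrite nuS hT /=.
have -> : class_of_term (App f (var_of ds)) <-> H (tDef (App f (var_of ds))).
  rewrite (saturated_tDef_var Hs); case E: class_of_term => [d|].
    by split=> // _; exists (val d); apply/class_of_termP; rewrite cls_val.
  by split=> // -[c /class_of_termP]; rewrite E.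
rewrite !(saturatedP Hs) derive_tDef_App; split=> [h|[]//]; split=> // i.
by rewrite ffunE; exact: derive_Tru.
Qed.

End TermModel.

(** * Model existence and completeness *)

(** Bound variables are doubled too, so no odd variable occurs at all; injectivity of doubling
    prevents capture. *)
Lemma even_variant (S : signature) (p : formula S) : exists q,
  is_subst (fun x => Var x.*2) p q /\ forall x, occ x q -> ~~ odd x.
Proof.
pose dbl x : term S := Var x.*2.
have dblU x : upd dbl x (Var x.*2) = dbl.
  by apply/funext => y; rewrite /upd; case: eqP => [->|].
have fr (x : var) (P : var -> bool) z : (z != x) && P z -> ~~ tocc x.*2 (dbl z).
  by case/andP=> zx _; rewrite /= (inj_eq double_inj) eq_sym.
have even t x : tocc x (tsubst dbl t) -> ~~ odd x.
  by move=> /tocc_tsubst[v _ /eqP->]; rewrite odd_double.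
have evenV y x : x == y.*2 -> ~~ odd x by move=> /eqP->; rewrite odd_double.
elim: p => [||t u|R ts|p [p' [sp ep]]|p [p' [sp ep]] q [q' [sq eq]]|
  p [p' [sp ep]] q [q' [sq eq]]|x p [p' [sp ep]]|x p [p' [sp ep]]].
- by exists Fls.
- by exists Tru.
- by exists (Eq (tsubst dbl t) (tsubst dbl u)); split=> // x /= /orP[] /even.
- exists (Rel R [ffun i => tsubst dbl (ts i)]); split=> // x /existsP[i].
  by rewrite ffunE => /even.
- by exists (Neg p'); split=> //; exists p'.
- by exists (And p' q'); split; [exists p', q'|move=> x /= /orP[/ep|/eq]].
- by exists (Or p' q'); split; [exists p', q'|move=> x /= /orP[/ep|/eq]].
- exists (All x.*2 p'); split; last by move=> y /= /orP[/evenV|/ep].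
  by exists x.*2, p'; split=> //; [exact: fr|rewrite dblU].
- exists (Ex x.*2 p'); split; last by move=> y /= /orP[/evenV|/ep].
  by exists x.*2, p'; split=> //; [exact: fr|rewrite dblU].
Qed.

(** The last clause serves completeness: in the term model it follows from D1 inside the saturated
    set. *)
Lemma model_existence (S : signature) (delta : isdef S) (rho : renaming delta)
    (G : set (formula S)) :
  ~ provable rho G Fls ->
  exists (M : structure S) (nu : assignment M), is_model delta G nu /\
    forall p, eval nu p = vT -> eval nu (Def rho p) = vT.
Proof.
move=> Gc.
have /choice[F FP] : forall p : formula S, exists q,
    is_subst (fun x => Var x.*2) p q /\ forall x, occ x q -> ~~ odd x.
  exact: even_variant.
have fG : odd_fresh [set F p | p in G].
  by exists 0 => _ x [p _ <-] /(proj2 (FP p))/negPf->.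
have [H [GH Hc Hcl Hpr Hw]] := henkin (consistent_double (fun p => proj1 (FP p)) Gc) fG.
have Hs : saturated rho H by split.
(* Sending [x] to the class of the variable [x.*2] evaluates [p] as its renamed copy [F p]. *)
have T p : eval (cls_assignment Hs double) p = vT <-> H (F p).
  by have [] := truth Hs (proj1 (FP p)).
exists (term_model Hs), (cls_assignment Hs double); split.
  split; first exact: term_model_isdef.
  by move=> p Gp; apply/T/GH; exists p.
move=> p /T /(saturated_Def Hs) h.
by apply/(proj1 (truth Hs (is_subst_Def (total_subst_Var rho double) (proj1 (FP p))))).
Qed.

Theorem theorem7p9 (S : signature) (delta : isdef S) (rho : renaming delta)
    (Gamma : set (formula S)) (phi : formula S) :
  (~ provable rho Gamma Fls ->
     exists (M : structure S) (nu : assignment M), is_model delta Gamma nu) /\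
  (entails delta Gamma phi -> provable rho Gamma phi).
Proof.
split=> [/model_existence[M [nu [Mnu _]]]|ent]; first by exists M, nu.
(* Applied to [phi] and to [Def phi], the two negative cases of C1; the second alternative is absurd
   for both, as the model would make the formula [p] false and true. *)
have refuted p : provable rho (Gamma `|` [set Neg p]) phi \/
    exists (M : structure S) (nu : assignment M), [/\ eval nu p = vF, eval nu phi = vT &
      eval nu (Def rho phi) = vT].
  have [GF|/model_existence[M [nu [[Mdelta MG] MD]]]] :=
    pselect (provable rho (Gamma `|` [set Neg p]) Fls).
    by left; exact: derive1 (C2 rho phi) GF.
  right; exists M, nu; have phiT : eval nu phi = vT.
    by apply: ent; split=> // q Gq; apply: MG; left.
  by split=> //; [apply/vneg_T; apply: (MG (Neg p)); right|exact: MD].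
apply: (excluded_fourth (p := phi)); first exact: assumptionU.
  by case: (refuted phi) => // -[M [nu [-> ]]].
by case: (refuted (Def rho phi)) => // -[M [nu [-> _]]].
Qed.
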